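(* Let $\lambda=(\lambda_n)$ be a frequency containing arbitrarily large arithmetic progressions, and let $1\le p\le\infty$. Then $\mathcal B=\{e^{-\lambda_n s}\}$ in $\mathcal H_p^\lambda$ satisfies any of the properties (i)–(vii) below if and only if $p=2$ (that is, for each one of the properties, $\mathcal B$ has that property if and only if $p=2$): (i) $\mathcal B$ is greedy; (ii) $\mathcal B$ is almost greedy; (iii) $\mathcal B$ is semi-greedy; (iv) $\mathcal B$ is quasi-greedy; (v) $\mathcal B$ is nearly unconditional; (vi) $\mathcal B$ is quasi-greedy for largest coefficients; (vii) $\mathcal B$ is suppression unconditional for constant coefficients (SUCC).
   Context: A frequency is a strictly increasing unbounded sequence $\lambda=(\lambda_n)_{n\ge1}$ of non-negative real numbers. It contains arbitrarily large arithmetic progressions if for every $N\in\mathbb N$ there are $a,b\in\mathbb R$ with $b>0$ such that $\{a+kb:k=1,\dots,N\}\subset\{\lambda_n:n\in\mathbb N\}$. A $\lambda$-Dirichlet polynomial is a finite sum $D=\sum_{n\in A}a_n e^{-\lambda_n s}$, with $A\subset\mathbb N$ finite and $a_n\in\mathbb C$. Its norms are $\|D\|_{\mathcal H_p^\lambda}=\lim_{R\to\infty}\big(\frac1{2R}\int_{-R}^R|\sum_{n\in A}a_n e^{-\lambda_n it}|^p\,dt\big)^{1/p}$ for $1\le p<\infty$ and $\|D\|_{\mathcal H_\infty^\lambda}=\sup_{t\in\mathbb R}|\sum_{n\in A}a_n e^{-i\lambda_n t}|$. For $1\le p<\infty$, $\mathcal H_p^\lambda$ is the completion of the space of $\lambda$-Dirichlet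 polynomials under $\|\cdot\|_{\mathcal H_p^\lambda}$; for $p=\infty$, $\mathcal B$ is regarded as a basis of the completion $\mathcal A_\infty^\lambda$ of the $\lambda$-Dirichlet polynomials under $\|\cdot\|_{\mathcal H_\infty^\lambda}$. In all cases $\mathcal B$ is a Markushevich basis, with the coefficient functionals as biorthogonal functionals. Let $\mathcal B=(\mathbf x_n)$ be a Markushevich basis of a Banach space $\mathbb X$ (its span is dense, and it has a total biorthogonal sequence $(\mathbf x_n^* )$ in $\mathbb X^*$). For $x\in\mathbb X$, $\operatorname{supp}(x)=\{j:\mathbf x_j^*(x)\ne0\}$; for finite $A\subset\mathbb N$, $P_A(x)=\sum_{j\in A}\mathbf x_j^*(x)\mathbf x_j$. A finite set $A\subset\mathbb N$ is a greedy set of $x$ if $|\mathbf x_j^*(x)|\ge|\mathbf x_k^*(x)|$ for all $j\in A$ and $k\in\mathbb N\setminus A$. $\mathcal E_A$ is the set of families $\varepsilon=(\varepsilon_j)_{j\in A}$ of scalars of modulus one and $\mathbf 1_{\varepsilon,A}=\sum_{j\in A}\varepsilon_j\mathbf x_j$. The basis is: - greedy if there is $C>0$ such that $\|x-P_A(x)\|\le C\inf\{\|x-y\|:|\operatorname{supp}(y)|\le|A|\}$ for all $x\in\mathbb X$ and all greedy sets $A$ of $x$; - almost greedy if there is $C>0$ such that $\|x-P_A(x)\|\le C\inf\{\|x-P_B(x)\|:B\subset\mathbb N,\ |B|\le|A|\}$ for all $x\in\mathbb X$ and all greedy sets $A$ of $x$; - semi-greedy if there is $C>0$ such that $\inf\{\|x-z\|:z\in\operatorname{span}\{\mathbf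 x_j:j\in A\}\}\le C\inf\{\|x-y\|:|\operatorname{supp}(y)|\le|A|\}$ for all $x\in\mathbb X$ and all greedy sets $A$ of $x$; - quasi-greedy if there is $C>0$ such that $\|P_A(x)\|\le C\|x\|$ for all $x\in\mathbb X$ and all greedy sets $A$ of $x$; - nearly unconditional if for each $t\in(0,1]$ there is $C(t)>0$ such that $\|P_A(x)\|\le C(t)\|x\|$ for every $x\in\mathbb X$ with $\sup_n|\mathbf x_n^*(x)|\le1$ and every finite $A\subset\{n:|\mathbf x_n^*(x)|\ge t\}$; - quasi-greedy for largest coefficients if there is $C>0$ such that $\|\mathbf 1_{\varepsilon,A}\|\le C\|\mathbf 1_{\varepsilon,A}+x\|$ for every finite $A\subset\mathbb N$, every $\varepsilon\in\mathcal E_A$ and every $x\in\mathbb X$ with $\operatorname{supp}(x)\cap A=\emptyset$ and $|\mathbf x_j^*(x)|\le1$ for all $j$; - SUCC if there is $C>0$ such that $\|\mathbf 1_{\varepsilon,A}\|\le C\|\mathbf 1_{\tilde\varepsilon,B}\|$ for all finite sets $A\subset B\subset\mathbb N$ and all $\varepsilon\in\mathcal E_A$, $\tilde\varepsilon\in\mathcal E_B$. *)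

(* Defs.v *)
From mathcomp Require Import all_boot all_order all_algebra.
From mathcomp Require Import finmap.
From mathcomp Require Import all_classical all_reals all_analysis.
From mathcomp Require Import complex.

Set Implicit Arguments.
Unset Strict Implicit.
Unset Printing Implicit Defensive.

Import Order.TTheory GRing.Theory Num.Theory.
Import numFieldNormedType.Exports.

Local Open Scope fset_scope.
Local Open Scope classical_set_scope.
Local Open Scope complex_scope.
Local Open Scope ring_scope.

(* Norms over the field R[i] take their values in R[i]; [rnorm v] is the same
   number as an element of R, where inf, sup, limits and C > 0 make sense. *)
Notation rnorm v := (complex.Re `|v|).

Section Frequencies.
Variable R : realType.

(* Sequences are indexed from 0: [lam n] is lambda_(n+1). *)
Definition frequency (lam : nat -> R) : Prop :=
  [/\ forall n, 0 <= lam n,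
      {homo lam : m n / (m < n)%N >-> m < n} &
      ~ has_ubound (range lam)].

Definition arbitrarily_large_AP (lam : nat -> R) : Prop :=
  forall N : nat, exists a b : R,
    0 < b /\ [set a + k%:R * b | k in [set k | (1 <= k <= N)%N]] `<=` range lam.

Definition cis (theta : R) : R[i] := cos theta +i* sin theta.

(* The Dirichlet polynomial sum_(n in A) a_n e^(- lam_n s) at s = i t. *)
Definition dirichlet_poly (lam : nat -> R) (A : {fset nat}) (a : nat -> R[i])
    (t : R) : R[i] :=
  \sum_(n <- A) a n * cis (- (lam n * t)).

(* The branch [_] is p = +oo (p = -oo is excluded by 1 <= p). *)
Definition Hp_norm (lam : nat -> R) (p : \bar R) (A : {fset nat})
    (a : nat -> R[i]) : R :=
  match p with
  | q%:E =>
      lim (((2 * T)^-1 *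
            (\int[lebesgue_measure]_(t in `[(- T), T])
               (rnorm (dirichlet_poly lam A a t) `^ q)%R)%R) `^ q^-1
           @[T --> +oo])
  | _ => sup (range (fun t : R => rnorm (dirichlet_poly lam A a t)))
  end.

(* The Banach space X, together with the vectors e n standing for
   e^(- lam_n s), is a completion of the lam-Dirichlet polynomials under the
   norm Hp_norm lam p: the map sum_(n in A) a_n e^(- lam_n s) |->
   sum_(n in A) a_n e_n is isometric with dense range in the complete space X.
   This determines (X, e) up to isometric isomorphism, as H_p^lam for p finite
   and as A_oo^lam for p = +oo. *)
Definition Hp_completion (lam : nat -> R) (p : \bar R)
    (X : completeNormedModType R[i]) (e : nat -> X) : Prop :=
  (forall (A : {fset nat}) (a : nat -> R[i]),
     rnorm (\sum_(n <- A) a n *: e n) = Hp_norm lam p A a) /\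
  dense [set x | exists (A : {fset nat}) (a : nat -> R[i]),
                   x = \sum_(n <- A) a n *: e n].

End Frequencies.

Section GreedyBases.
Context {R : realType} {X : normedModType R[i]}.
Variables (e : nat -> X) (es : nat -> {linear X -> R[i]^o}).

(* Continuous coefficient functionals of e. When the span of e is dense they
   are uniquely determined by e. *)
Definition coefficient_functionals : Prop :=
  (forall n, continuous (es n)) /\ (forall m n, es m (e n) = (m == n)%:R).

Definition bsupp (x : X) : set nat := [set j | es j x != 0].

Definition bproj (A : {fset nat}) (x : X) : X := \sum_(j <- A) es j x *: e j.

Definition greedy_set (x : X) (A : {fset nat}) : Prop :=
  forall j k, j \in A -> k \notin A -> `|es k x| <= `|es j x|.

Definition unimodular_on (A : {fset nat}) (eps : nat -> R[i]) : Prop :=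
  forall j, j \in A -> `|eps j| = 1.

Definition indic_sum (eps : nat -> R[i]) (A : {fset nat}) : X :=
  \sum_(j <- A) eps j *: e j.

Definition best_error (x : X) (m : nat) : R :=
  inf [set rnorm (x - y) | y in [set y | (bsupp y #<= `I_m)%card]].

Definition best_proj_error (x : X) (m : nat) : R :=
  inf [set rnorm (x - bproj B x) | B in [set B : {fset nat} | (#|` B| <= m)%N]].

Definition dist_span (x : X) (A : {fset nat}) : R :=
  inf [set rnorm (x - \sum_(j <- A) c j *: e j) | c in [set: nat -> R[i]]].

Definition greedy : Prop :=
  exists2 C : R, 0 < C & forall x A, greedy_set x A ->
    rnorm (x - bproj A x) <= C * best_error x #|` A|.

Definition almost_greedy : Prop :=
  exists2 C : R, 0 < C & forall x A, greedy_set x A ->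
    rnorm (x - bproj A x) <= C * best_proj_error x #|` A|.

Definition semi_greedy : Prop :=
  exists2 C : R, 0 < C & forall x A, greedy_set x A ->
    dist_span x A <= C * best_error x #|` A|.

Definition quasi_greedy : Prop :=
  exists2 C : R, 0 < C & forall x A, greedy_set x A ->
    rnorm (bproj A x) <= C * rnorm x.

Definition nearly_unconditional : Prop :=
  forall t : R, 0 < t <= 1 ->
    exists2 C : R, 0 < C & forall (x : X) (A : {fset nat}),
      (forall n, rnorm (es n x) <= 1) ->
      (forall n, n \in A -> t <= rnorm (es n x)) ->
      rnorm (bproj A x) <= C * rnorm x.

Definition quasi_greedy_largest_coefs : Prop :=
  exists2 C : R, 0 < C & forall (A : {fset nat}) (eps : nat -> R[i]) (x : X),
    unimodular_on A eps ->
    bsupp x `&` [set` A] = set0 ->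
    (forall j, rnorm (es j x) <= 1) ->
    rnorm (indic_sum eps A) <= C * rnorm (indic_sum eps A + x).

Definition SUCC : Prop :=
  exists2 C : R, 0 < C &
    forall (A B : {fset nat}) (eps eps' : nat -> R[i]),
      (A `<=` B)%fset -> unimodular_on A eps -> unimodular_on B eps' ->
      rnorm (indic_sum eps A) <= C * rnorm (indic_sum eps' B).

End GreedyBases.

(* Main.v *)
Require Import Defs.
From mathcomp Require Import all_boot all_order all_algebra.
From mathcomp Require Import finmap.
From mathcomp Require Import all_classical all_reals all_analysis.
From mathcomp Require Import complex.
From mathcomp Require Import ring lra.

Set Implicit Arguments.
Unset Strict Implicit.
Unset Printing Implicit Defensive.

Import Order.TTheory GRing.Theory Num.Theory.
Import numFieldNormedType.Exports.

Local Open Scope classical_set_scope.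
Local Open Scope complex_scope.
Local Open Scope ring_scope.

(** For [p = 2] the mean of the square of a Dirichlet polynomial is the sum of the
    squares of the moduli of its coefficients ([Hp_norm2]), so the space is a
    Hilbert space with orthonormal basis. Pythagoras' theorem, which passes from
    finite sums to all vectors by density ([pythagoras]), makes the projections
    contractive, and a greedy set collects at least as much of the square sum of
    the coefficients as any set of the same size ([greedy_sum_le]), so greedy
    projections are best approximations. All seven properties hold with constant
    one.

    For [p <> 2] take a progression [a + k * b], [k < n], inside the frequencies.
    On it the norm is that of the trigonometric polynomial with the same
    coefficients, whatever [a] is ([norm_progression]). Two choices of signs are
    compared, for [n] a power of 2. With Rudin-Shapiro signs the modulus is at
    most [sqrt (2 * n)] everywhere while its mean square is [n], so the norm is of
    order [sqrt n] for every [p]. With all signs equal one gets a Dirichlet kernel,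
    whose mean square [n] concentrates near the points where all terms are equal;
    so its norm is large against [sqrt n] for [p > 2] and small against it for
    [p < 2]. The concentration is made quantitative with a Fejer kernel of a much
    smaller order [m] as a weight: its mean is [m%:R^-1], and outside of it only a
    bounded part of the square of the Dirichlet kernel remains
    ([fejer_weight_localizes]). Comparing the power with affine functions of the
    square then needs nothing but the means of squared moduli, which are known
    exactly. The result is [besicovitch_gap]: for one of the two choices of signs
    the norm exceeds any given multiple of the norm for the other.

    Hence no inequality can bound sums with one choice of signs by the same sums
    with another one ([not_sign_bounded]). The condition SUCC is such an
    inequality; every other property except semi-greediness implies
    quasi-greediness for largest coefficients, and that property yields such an
    inequality by splitting the set where the signs agree and disagree
    ([largest_coefs_sign_bounded]). Semi-greediness compares sums on disjoint
    sets; it is refuted by placing the two sums on the even and odd places of one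
    progression ([not_semi_greedy]). *)

(** * Mean values of functions on the line *)

Section Means.
Variable R : realType.
Implicit Types (g G : R -> R) (a b l T : R).

Local Notation mu := (@lebesgue_measure R).

Lemma continuous_integrable_itv g a b :
  continuous g -> mu.-integrable `[a, b] (EFin \o g).
Proof.
move=> gc; apply: continuous_compact_integrable; first exact: segment_compact.
exact: continuous_subspaceT.
Qed.

(** The integral from 0 to [x], with the sign reversed for negative [x], is a
    primitive on the whole line: to the right of any [- M] it differs by a
    constant from the integral from [- M] to [x], whose derivative is known. *)
Lemma primitive_exists g : continuous g ->
  exists G, forall x : R, is_derive x 1 G (g x).
Proof.
move=> gc.
pose I a b := \int[mu]_(t in `[a, b]) g t.
pose G x : R := if 0 <= x then I 0 x else - I x 0.
exists G => x.
pose M := `|x| + 1.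
have M0 : 0 < M by rewrite /M ltr_wpDl.
have Mx : - M < x by rewrite ltrNl (le_lt_trans (ler_norm _))// normrN /M ltrDl.
have split y z : - M <= y -> y <= z -> I (- M) z - I (- M) y = I y z.
  move=> My yz; rewrite /I Rintegral_itvB ?bnd_simp//.
    rewrite Rintegral_itv_obnd_cbnd//.
    apply: (integrableS _ _ _ (continuous_integrable_itv y z gc)) => //.
    exact: subset_itv_oc_cc.
  exact: continuous_integrable_itv.
have GE : \forall y \near x, I (- M) y - I (- M) 0 = G y.
  near=> y.
  have My : - M < y.
    near: y; apply: lt_nbhsr => //.
  rewrite /G; case: ifPn => [y0|]; first by rewrite split// lerNl oppr0 ltW.
  rewrite -ltNge => y0.
  by rewrite -(split _ _ (ltW My) (ltW y0)) opprB.
have [dF F'] : derivable (fun y => I (- M) y) x 1 /\ (fun y => I (- M) y)^`()%classic x = g x.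
  apply: (@continuous_FTC1_closed R g (- M) x (x + 1)) => //.
  - by rewrite ltrDl.
  - exact: continuous_integrable_itv.
  - exact: gc.
have D : is_derive x 1 (fun y => I (- M) y - I (- M) 0) (g x).
  have H : is_derive x 1 (fun y => I (- M) y) (g x).
    exact: (DeriveDef dF (etrans (esym (derive1E _ _)) F')).
  by rewrite -[g x]subr0; apply: is_deriveB.
by apply: near_eq_is_derive D => //; rewrite ?oner_neq0.
Unshelve. all: end_near. Qed.

Lemma is_derive_continuous g G : (forall x : R, is_derive x 1 G (g x)) ->
  continuous G.
Proof.
by move=> dG x; apply: differentiable_continuous; apply/derivable1_diffP; case: (dG x).
Qed.

Lemma Rintegral_primitive g G a b : continuous g ->
  (forall x : R, is_derive x 1 G (g x)) -> a < b ->
  \int[mu]_(t in `[a, b]) g t = G b - G a.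
Proof.
move=> gc dG ab.
have Gc := is_derive_continuous dG.
rewrite /Rintegral (@continuous_FTC2 R g G)//.
- exact: continuous_subspaceT.
- split=> [x _||]; first by case: (dG x).
  + by apply: cvg_at_right_filter; exact: Gc.
  + by apply: cvg_at_left_filter; exact: Gc.
- by move=> x _; rewrite derive1E; case: (dG x).
Qed.

(** A relation, because the integral means of a bounded function need not
    converge. *)
Definition mean_value g l :=
  (2 * T)^-1 * \int[mu]_(t in `[(- T), T]) g t @[T --> +oo] --> l.

(** The mean from [- T] to [T] is a difference quotient of [G]; replacing [G x]
    by [l * x] changes it by at most [2 * B / (2 * T)]. *)
Lemma mean_value_primitive g G l (B : R) : continuous g ->
  (forall x : R, is_derive x 1 G (g x)) ->
  (forall x, `|G x - l * x| <= B) -> mean_value g l.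
Proof.
move=> gc dG GB.
have B0 : 0 <= B by rewrite (le_trans _ (GB 0)).
apply/cvgrPdist_le => /= e e0.
near=> T.
have T0 : 0 < T by near: T; apply: nbhs_pinfty_gt; rewrite num_real.
rewrite (Rintegral_primitive gc dG)//; last by rewrite gtrN.
have -> : l - (2 * T)^-1 * (G T - G (- T)) =
  (2 * T)^-1 * ((G (- T) - l * - T) - (G T - l * T)) by field; rewrite gt_eqF.
rewrite normrM gtr0_norm ?invr_gt0 ?mulr_gt0//.
rewrite ler_pdivrMl ?mulr_gt0//.
rewrite (le_trans (ler_normB _ _))//.
rewrite (le_trans (lerD (GB _) (GB _)))//.
rewrite -mulr2n -(mulr_natl B) -mulrA ler_wpM2l//.
rewrite -ler_pdivrMr//; near: T; apply: nbhs_pinfty_ge; rewrite num_real//.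
Unshelve. all: end_near. Qed.

Lemma mean_value_cst (k : R) : mean_value (cst k) k.
Proof.
apply: (@mean_value_primitive _ (fun x => k * x) _ 0) => [x|x|x].
- exact: cvg_cst.
- by rewrite -[cst k x]mulr1; apply: is_deriveZ.
- by rewrite subrr normr0.
Qed.

Lemma mean_valueD g1 g2 l1 l2 : continuous g1 -> continuous g2 ->
  mean_value g1 l1 -> mean_value g2 l2 ->
  mean_value (fun t => g1 t + g2 t) (l1 + l2).
Proof.
move=> c1 c2 m1 m2; rewrite /mean_value.
rewrite (_ : (fun T => _) = (fun T => (2 * T)^-1 * \int[mu]_(t in `[(- T), T]) g1 t +
    (2 * T)^-1 * \int[mu]_(t in `[(- T), T]) g2 t)); first exact: cvgD m1 m2.
by apply/funext => T; rewrite RintegralD -?mulrDr//; exact: continuous_integrable_itv.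
Qed.

Lemma mean_valueZ g l (k : R) : continuous g ->
  mean_value g l -> mean_value (fun t => k * g t) (k * l).
Proof.
move=> gc m; rewrite /mean_value.
rewrite (_ : (fun T => _) = (fun T => k * ((2 * T)^-1 *
    \int[mu]_(t in `[(- T), T]) g t))); first exact: cvgM (cvg_cst k) m.
by apply/funext => T; rewrite RintegralZl 1?mulrCA//; exact: continuous_integrable_itv.
Qed.

Lemma continuous_add g1 g2 : continuous g1 -> continuous g2 ->
  continuous (fun t => g1 t + g2 t).
Proof. by move=> c1 c2 t; apply: cvgD (c1 t) (c2 t). Qed.

Lemma continuous_scale (k : R) g : continuous g -> continuous (fun t => k * g t).
Proof. by move=> gc t; apply: cvgM (cvg_cst _) (gc t). Qed.

Lemma continuous_cos_scale (w : R) : continuous (fun t => cos (w * t)).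
Proof.
by move=> t; apply: continuous_comp; [exact: mulrl_continuous|exact: continuous_cos].
Qed.

Lemma continuous_sin_scale (w : R) : continuous (fun t => sin (w * t)).
Proof.
by move=> t; apply: continuous_comp; [exact: mulrl_continuous|exact: continuous_sin].
Qed.

Lemma continuous_sum (I : Type) (r : seq I) (g : I -> R -> R) :
  (forall i, continuous (g i)) -> continuous (fun t => \sum_(i <- r) g i t).
Proof.
move=> gc; elim: r => [|i r IH].
  by under eq_fun do rewrite big_nil; move=> t; exact: cvg_cst.
by under eq_fun do rewrite big_cons; exact: continuous_add.
Qed.

Lemma mean_value_sum (I : Type) (r : seq I) (g : I -> R -> R) (l : I -> R) :
  (forall i, continuous (g i)) -> (forall i, mean_value (g i) (l i)) ->
  mean_value (fun t => \sum_(i <- r) g i t) (\sum_(i <- r) l i).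
Proof.
move=> gc gm; elim: r => [|i r IH].
  rewrite big_nil (_ : (fun _ => _) = cst 0); first exact: mean_value_cst.
  by apply/funext => t; rewrite big_nil.
rewrite big_cons (_ : (fun _ => _) = (fun t => g i t + \sum_(j <- r) g j t)); last first.
  by apply/funext => t; rewrite big_cons.
apply: mean_valueD => //; exact: continuous_sum.
Qed.

Lemma mean_value_le g1 g2 l1 l2 : continuous g1 -> continuous g2 ->
  mean_value g1 l1 -> mean_value g2 l2 ->
  (forall t, g1 t <= g2 t) -> l1 <= l2.
Proof.
move=> c1 c2 m1 m2 le12.
apply: (ler_cvg_to m1 m2); near=> T.
have T0 : 0 < T by near: T; apply: nbhs_pinfty_gt; rewrite num_real.
apply: ler_wpM2l; first by rewrite invr_ge0 mulr_ge0// ltW.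
rewrite -subr_ge0.
rewrite -RintegralB//=; try exact: continuous_integrable_itv.
by apply: Rintegral_ge0 => x _; rewrite subr_ge0.
Unshelve. all: end_near. Qed.

Lemma mean_value_cos (w : R) : mean_value (fun t => cos (w * t)) (w == 0)%:R.
Proof.
have [->|w0] := eqVneq w 0.
  rewrite (_ : (fun _ => _) = cst 1); first exact: mean_value_cst.
  by apply/funext => t; rewrite mul0r cos0.
apply: (@mean_value_primitive _ (fun x => w^-1 * sin (w * x)) _ `|w|^-1) => [x|x|x].
- exact: continuous_cos_scale.
- rewrite -[cos _](mulKf w0) (mulrC w) ; apply: is_deriveZ.
  apply: (is_derive1_comp (f := sin)); rewrite -[X in is_derive _ _ _ X]mulr1; exact: is_deriveZ.
- by rewrite mul0r subr0 normrM normfV ler_piMr ?invr_ge0// sin_max.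
Qed.

Lemma mean_value_sin (w : R) : mean_value (fun t => sin (w * t)) 0.
Proof.
have [->|w0] := eqVneq w 0.
  rewrite (_ : (fun _ => _) = cst 0); first exact: mean_value_cst.
  by apply/funext => t; rewrite mul0r sin0.
apply: (@mean_value_primitive _ (fun x => - w^-1 * cos (w * x)) _ `|w|^-1) => [x|x|x].
- exact: continuous_sin_scale.
- rewrite (_ : sin (w * x) = - w^-1 * (- sin (w * x) * w)); last by field.
  apply: is_deriveZ.
  apply: (is_derive1_comp (f := cos)); rewrite -[X in is_derive _ _ _ X]mulr1; exact: is_deriveZ.
- by rewrite mul0r subr0 normrM normrN normfV ler_piMr ?invr_ge0// cos_max.
Qed.

(** If [G] is a primitive of a [P]-periodic function then [G (x + P) - G x] is a
    constant [c], so [G x - (c / P) * x] is continuous and periodic, hence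
    bounded, and [c / P] is the mean. Translating the function translates [G] and
    leaves [c] unchanged. *)
Lemma mean_value_periodic g (P : R) : 0 < P -> continuous g ->
  (forall t, g (t + P) = g t) ->
  exists2 l, mean_value g l & forall h, mean_value (fun t => g (t + h)) l.
Proof.
move=> P0 gc gP.
have [G dG] := primitive_exists gc.
have Gc := is_derive_continuous dG.
have dGs h (x : R) : is_derive x 1 (fun x => G (x + h)) (g (x + h)).
  rewrite -[g _]mulr1; apply: (is_derive1_comp (f := G)).
  by rewrite -[X in is_derive _ _ _ X]addr0; apply: is_deriveD.
pose c := G P - G 0.
have GP x : G (x + P) - G x = c.
  rewrite /c -{2}[P]add0r.
  apply: (@is_derive_0_is_cst _ (fun x => G (x + P) - G x)) => y.
  rewrite -(subrr (g y)) -{1}gP; apply: is_deriveB.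
pose l := c / P.
pose H x := G x - l * x.
have HP x : H (x + P) = H x.
  rewrite /H; have -> : G (x + P) = c + G x by rewrite -(GP x) subrK.
  by rewrite /l; field; rewrite gt_eqF.
have Hc : continuous H.
  move=> x; apply: cvgB; [exact: Gc|exact: mulrl_continuous].
have nHc : continuous (fun x => `|H x|).
  by move=> x; apply: cvg_norm; exact: Hc.
have [x0 _ Hmax] := EVT_max (ltW P0) (continuous_subspaceT nHc).
have Hn (n : nat) x : H (x + P *+ n) = H x.
  elim: n => [|n IH]; first by rewrite mulr0n addr0.
  by rewrite mulrSr addrA HP.
(* Every point has a translate by a multiple of P in the period [0, P]. *)
have HB x : `|H x| <= `|H x0|.
  pose k := Num.floor (x / P).
  have Hk : H x = H (x - k%:~R * P).
    case: k => n.
      by rewrite -[in LHS](subrK (n%:~R * P) x) [X in _ + X]mulr_natl Hn.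
    by rewrite NegzE mulrNz mulNr opprK [X in _ + X]mulr_natl -(Hn n.+1).
  rewrite Hk; apply: Hmax; rewrite in_itv/=.
  have /andP[k1 k2] := mem_rg1_floor (x / P).
  move: k1 k2; rewrite ?bnd_simp -/k ler_pdivlMr// ltr_pdivrMr// => k1 k2.
  by rewrite subr_ge0 k1/= lerBlDl (le_trans (ltW k2))// mulrDl mul1r.
have key h : mean_value (fun t => g (t + h)) l.
  apply: (@mean_value_primitive _ (fun x => G (x + h)) _ (`|H x0| + `|l * h|)) => // [x|x].
    by apply: continuous_comp; [apply: cvgD; [exact: cvg_id|exact: cvg_cst]|exact: gc].
  have -> : G (x + h) - l * x = H (x + h) + l * h by rewrite /H; ring.
  by rewrite (le_trans (ler_normD _ _))// lerD2r.
exists l => //.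
by have := key 0; rewrite (_ : (fun t => g (t + 0)) = g)//; apply/funext => t; rewrite addr0.
Qed.

End Means.

(** * The modulus of complex numbers and the norm of vectors as real numbers *)

Section Modulus.
Variable R : realType.
Implicit Types (V W : normedZmodType R[i]) (c d : R[i]) (x y : R).

Lemma ReD c d : complex.Re (c + d) = complex.Re c + complex.Re d.
Proof. by case: c => ? ?; case: d. Qed.

Lemma ImD c d : complex.Im (c + d) = complex.Im c + complex.Im d.
Proof. by case: c => ? ?; case: d. Qed.

Lemma rnormE V (v : V) : `|v| = (rnorm v)%:C.
Proof. by rewrite RRe_real. Qed.

Lemma sqr_normE V (v : V) : `|v| ^+ 2 = (rnorm v ^+ 2)%:C.
Proof. by rewrite {1}rnormE -rmorphXn. Qed.

Lemma le_rnorm V (u v : V) : (`|u| <= `|v|) = (rnorm u <= rnorm v).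
Proof. by rewrite (rnormE u) (rnormE v) lecR. Qed.

Lemma rnorm_ge0 V (v : V) : 0 <= rnorm v.
Proof. by have := normr_ge0 v; rewrite rnormE ler0c. Qed.

Lemma ler_sqr_rnorm V W (u : V) (v : W) :
  (rnorm u ^+ 2 <= rnorm v ^+ 2) = (rnorm u <= rnorm v).
Proof. by rewrite ler_pXn2r// nnegrE rnorm_ge0. Qed.

Lemma rnormD V (u v : V) : rnorm (u + v) <= rnorm u + rnorm v.
Proof. by rewrite -ReD -lecR -rnormE RRe_real ?ler_normD// rpredD. Qed.

Lemma rnormN V (v : V) : rnorm (- v) = rnorm v.
Proof. by rewrite normrN. Qed.

Lemma rnormB V (u v : V) : rnorm (u - v) <= rnorm u + rnorm v.
Proof. by rewrite -(rnormN v) rnormD. Qed.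

Lemma rnorm0 V : rnorm (0 : V) = 0.
Proof. by rewrite normr0. Qed.

Lemma rnorm_sum V (I : Type) (r : seq I) (P : pred I) (F : I -> V) :
  rnorm (\sum_(i <- r | P i) F i) <= \sum_(i <- r | P i) rnorm (F i).
Proof.
elim/big_ind2 : _ => [|u x v y ux vy|//]; first by rewrite rnorm0.
by rewrite (le_trans (rnormD _ _))// lerD.
Qed.

Lemma rnormM c d : rnorm (c * d) = rnorm c * rnorm d.
Proof. exact: Normc.normcM. Qed.

Lemma rnorm1 : rnorm (1 : R[i]) = 1.
Proof. by rewrite normr1. Qed.

Lemma rnormX c n : rnorm (c ^+ n) = rnorm c ^+ n.
Proof. by elim: n => [|n IH]; rewrite ?expr0 ?rnorm1// !exprS rnormM IH. Qed.

Lemma sqr_rnorm c : rnorm c ^+ 2 = complex.Re c ^+ 2 + complex.Im c ^+ 2.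
Proof. by case: c => x y; rewrite /= sqr_sqrtr// addr_ge0 ?sqr_ge0. Qed.

Lemma rnorm_sqrt c : rnorm c = Num.sqrt (rnorm c ^+ 2).
Proof. by rewrite sqrtr_sqr; apply/esym/ger0_norm; exact: rnorm_ge0. Qed.

Lemma rnorm_eq1 c : (rnorm c == 1) = (`|c| == 1).
Proof. by rewrite rnormE -(inj_eq (@complexI R)). Qed.

Lemma cis0 : cis (0 : R) = 1.
Proof. by rewrite /cis cos0 sin0. Qed.

Lemma cisD x y : cis (x + y) = cis x * cis y.
Proof. by rewrite /cis cosD sinD; simpc; congr (_ +i* _); rewrite addrC. Qed.

Lemma rnorm_cis x : rnorm (cis x) = 1.
Proof.
apply/eqP; rewrite -(eqrXn2 (n := 2)) ?rnorm_ge0// sqr_rnorm expr1n /=.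
by rewrite cos2Dsin2.
Qed.

Lemma cisX x n : cis (x *+ n) = cis x ^+ n.
Proof. by elim: n => [|n IH]; rewrite ?cis0// mulrS exprS cisD IH. Qed.

End Modulus.

(** * Trigonometric sums and their norms *)

Section TrigonometricSums.
Variable R : realType.
Implicit Types (mu : nat -> R) (a : nat -> R[i]) (r : seq nat) (q : R).

Definition tsum mu r a (t : R) : R[i] := \sum_(n <- r) a n * cis (- (mu n * t)).

(** In this form both continuity and the mean value can be read off term by
    term: the mean of a cosine or sine vanishes unless its frequency is zero. *)
Lemma sqr_rnorm_tsum mu r a t : rnorm (tsum mu r a t) ^+ 2 =
  \sum_(m <- r) \sum_(n <- r)
    ((complex.Re (a m) * complex.Re (a n) + complex.Im (a m) * complex.Im (a n))
       * cos ((mu m - mu n) * t)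
   + (complex.Im (a m) * complex.Re (a n) - complex.Re (a m) * complex.Im (a n))
       * sin ((mu m - mu n) * t)).
Proof.
pose u n := complex.Re (a n * cis (- (mu n * t))).
pose v n := complex.Im (a n * cis (- (mu n * t))).
have -> : rnorm (tsum mu r a t) ^+ 2 =
    (\sum_(n <- r) u n) ^+ 2 + (\sum_(n <- r) v n) ^+ 2.
  rewrite sqr_rnorm /tsum; congr (_ ^+ 2 + _ ^+ 2).
    by rewrite (big_morph (@complex.Re R) (@ReD R) (erefl _)).
  by rewrite (big_morph (@complex.Im R) (@ImD R) (erefl _)).
rewrite !expr2 !big_distrlr/= -big_split/=; apply: eq_bigr => m _.
rewrite -big_split/=; apply: eq_bigr => n _.
rewrite /u /v /cis; case: (a m) => am bm; case: (a n) => an bn.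
simpc; rewrite /= !cosN !sinN (mulrBl t) cosB sinB; ring.
Qed.

Lemma continuous_sqr_rnorm_tsum mu r a :
  continuous (fun t => rnorm (tsum mu r a t) ^+ 2).
Proof.
under eq_fun do rewrite sqr_rnorm_tsum.
apply: continuous_sum => m; apply: continuous_sum => n.
by apply: continuous_add; apply: continuous_scale;
  [exact: continuous_cos_scale|exact: continuous_sin_scale].
Qed.

Lemma continuous_rnorm_tsum mu r a : continuous (fun t => rnorm (tsum mu r a t)).
Proof.
rewrite (_ : (fun _ => _) = (fun t => Num.sqrt (rnorm (tsum mu r a t) ^+ 2))).
  move=> t; apply: (continuous_comp (@continuous_sqr_rnorm_tsum mu r a t)).
  exact: sqrt_continuous.
by apply/funext => t; exact: rnorm_sqrt.
Qed.

(** Parseval: only the diagonal terms have a nonzero mean. *)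
Lemma mean_sqr_tsum mu r a : uniq r -> {in r &, injective mu} ->
  mean_value (fun t => rnorm (tsum mu r a t) ^+ 2) (\sum_(n <- r) rnorm (a n) ^+ 2).
Proof.
move=> ur injmu; under eq_fun do rewrite sqr_rnorm_tsum.
have -> : \sum_(n <- r) rnorm (a n) ^+ 2 = \sum_(m <- r) \sum_(n <- r)
   ((complex.Re (a m) * complex.Re (a n) + complex.Im (a m) * complex.Im (a n))
       * (mu m - mu n == 0)%:R
   + (complex.Im (a m) * complex.Re (a n) - complex.Re (a m) * complex.Im (a n))
       * 0).
  rewrite [LHS]big_seq [RHS]big_seq; apply: eq_bigr => m mr.
  rewrite (bigD1_seq m)//= big_seq_cond big1 => [|n /andP[nr nm]].
    by rewrite subrr eqxx addr0 mulr0 addr0 mulr1 sqr_rnorm !expr2.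
  rewrite mulr0 addr0 (_ : (_ == 0) = false) ?mulr0//.
  by rewrite subr_eq0; apply/negP => /eqP /injmu E; rewrite E ?eqxx in nm.
apply: mean_value_sum => m.
  apply: continuous_sum => n; apply: continuous_add; apply: continuous_scale;
  [exact: continuous_cos_scale|exact: continuous_sin_scale].
have cc n := continuous_cos_scale (w := mu m - mu n).
have cs n := continuous_sin_scale (w := mu m - mu n).
apply: mean_value_sum => n.
  by apply: continuous_add; exact: continuous_scale.
apply: mean_valueD; [exact: continuous_scale|exact: continuous_scale| |].
  by apply: mean_valueZ; [exact: cc|exact: mean_value_cos].
by apply: mean_valueZ; [exact: cs|exact: mean_value_sin].
Qed.

(** Nonnegativity matters only for [l = 0]: the power of a negative number is 1
    by convention, so the power function is continuous at 0 only along
    nonnegative values. *)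
Lemma cvg_powR_ge0 (T : Type) (F : set_system T) (FF : Filter F) (f : T -> R) (l q : R) :
  0 < q -> 0 <= l -> (\forall x \near F, 0 <= f x) ->
  f x @[x --> F] --> l -> f x `^ q @[x --> F] --> l `^ q.
Proof.
move=> q0; rewrite le_eqVlt => /orP[/eqP<- f0 fl|l0 _ fl].
  rewrite powR0 ?gt_eqF//; apply/cvgrPdist_lt => e e0.
  have eq0 : 0 < e `^ q^-1 by rewrite powR_gt0.
  move/cvgrPdist_lt : fl => /(_ _ eq0) fl.
  near=> x.
  have fx0 : 0 <= f x by near: x.
  have : `|0 - f x| < e `^ q^-1 by near: x.
  rewrite !sub0r !normrN ger0_norm// ger0_norm ?powR_ge0// => fxe.
  rewrite -[ltRHS](powRr1 (ltW e0)) -(mulVf (lt0r_neq0 q0)) powRrM.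
  by rewrite gt0_ltr_powR// nnegrE ?powR_ge0.
have c : {for l, continuous (fun x : R => x `^ q)}.
  apply: differentiable_continuous; apply/derivable1_diffP.
  by apply: derivable_powR; rewrite in_itv/= l0.
exact: (cvg_comp _ _ fl c).
Unshelve. all: end_near. Qed.

Lemma continuous_powR_tsum mu r a q : 0 < q ->
  continuous (fun t => rnorm (tsum mu r a t) `^ q).
Proof.
move=> q0 t; apply: cvg_powR_ge0 => //; first exact: rnorm_ge0.
  by near=> x; exact: rnorm_ge0.
exact: continuous_rnorm_tsum.
Unshelve. all: end_near. Qed.

(** The norm of a Dirichlet polynomial depends only on its modulus on the
    imaginary axis; this is that dependence. *)
Definition besicovitch_norm (p : \bar R) (u : R -> R) : R :=
  match p with
  | q%:E => lim (((2 * T)^-1 *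
            (\int[lebesgue_measure]_(t in `[(- T), T]) (u t `^ q)%R)%R) `^ q^-1
           @[T --> +oo])
  | _ => sup (range u)
  end.

Lemma Hp_norm_besicovitch lam p (A : {fset nat}) a :
  Hp_norm lam p A a = besicovitch_norm p (fun t => rnorm (tsum lam A a t)).
Proof. by []. Qed.

Lemma mean_value_ge0 (g : R -> R) l : (forall t, 0 <= g t) -> mean_value g l -> 0 <= l.
Proof.
move=> g0 gl; apply: (cvgr_to_ge gl); near=> T.
have T0 : 0 < T by near: T; apply: nbhs_pinfty_gt; rewrite num_real.
apply: mulr_ge0; first by rewrite invr_ge0 mulr_ge0// ltW.
by apply: Rintegral_ge0 => t _; exact: g0.
Unshelve. all: end_near. Qed.

Lemma besicovitch_norm_mean q (u : R -> R) l : 0 < q ->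
  mean_value (fun t => u t `^ q) l -> besicovitch_norm q%:E u = l `^ q^-1.
Proof.
move=> q0 ul; apply: cvg_lim => //; apply: cvg_powR_ge0 => //.
- by rewrite invr_gt0.
- by apply: mean_value_ge0 ul => t; exact: powR_ge0.
near=> T.
have T0 : 0 < T by near: T; apply: nbhs_pinfty_gt; rewrite num_real.
apply: mulr_ge0; first by rewrite invr_ge0 mulr_ge0// ltW.
by apply: Rintegral_ge0 => x _; exact: powR_ge0.
Unshelve. all: end_near. Qed.

Lemma Hp_norm2 lam (A : {fset nat}) a : injective lam ->
  Hp_norm lam 2%:E A a ^+ 2 = \sum_(n <- A) rnorm (a n) ^+ 2.
Proof.
move=> inj; rewrite Hp_norm_besicovitch.
rewrite (@besicovitch_norm_mean 2 _ (\sum_(n <- A) rnorm (a n) ^+ 2))//.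
  rewrite powR12_sqrt ?sqr_sqrtr// sumr_ge0// => n _; exact: sqr_ge0.
rewrite (_ : (fun _ => _) = (fun t => rnorm (tsum lam A a t) ^+ 2)).
  apply: mean_sqr_tsum; [exact: fset_uniq|move=> x y _ _; exact: inj].
by apply/funext => t; rewrite powR_mulrn// rnorm_ge0.
Qed.

End TrigonometricSums.

(** * Geometric sums and Rudin-Shapiro polynomials on the unit circle *)

Section UnimodularSums.
Variable R : realType.
Implicit Types (z : R[i]) (m n k : nat).

Lemma rnorm_geometric z n : rnorm z = 1 ->
  rnorm (1 - z) * rnorm (\sum_(k < n) z ^+ k) <= 2.
Proof.
move=> z1; rewrite -rnormM -opprB mulNr -subrX1 rnormN.
by rewrite (le_trans (rnormB _ _))// rnormX z1 expr1n rnorm1.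
Qed.

Lemma rnorm_geometric_le z n : rnorm z = 1 ->
  rnorm (\sum_(k < n) z ^+ k) <= n%:R.
Proof.
move=> z1; rewrite (le_trans (rnorm_sum _ _ _))//.
rewrite (eq_bigr (fun=> 1)) => [|k _]; last by rewrite rnormX z1 expr1n.
by rewrite sumr_const card_ord.
Qed.

Lemma rnorm_1subX z k : rnorm z = 1 -> rnorm (1 - z ^+ k) <= k%:R * rnorm (1 - z).
Proof.
move=> z1; rewrite -opprB subrX1 rnormN rnormM -[X in rnorm X * _]opprB rnormN mulrC.
by apply: ler_wpM2r; [exact: rnorm_ge0|exact: rnorm_geometric_le].
Qed.

Lemma Re_unimodular z : rnorm z = 1 ->
  complex.Re z = 1 - rnorm (1 - z) ^+ 2 / 2.
Proof.
move=> z1; have := sqr_rnorm z; rewrite z1 sqr_rnorm expr1n.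
by case: z {z1} => x y /= E; simpc => /=; lra.
Qed.

(** The real part of [z ^+ k] is [1 - rnorm (1 - z ^+ k) ^+ 2 / 2], and
    [rnorm (1 - z ^+ k)] is at most [m * rnorm (1 - z)]; so the real part [x] of
    the sum is at least [m - m ^+ 3 * w / 2], and [x ^+ 2 >= 2 * m * x - m ^+ 2]. *)
Lemma rnorm_geometric_ge z m : rnorm z = 1 ->
  m%:R ^+ 2 - rnorm (\sum_(k < m) z ^+ k) ^+ 2 <= m%:R ^+ 4 * rnorm (1 - z) ^+ 2.
Proof.
move=> z1; set w := rnorm (1 - z) ^+ 2; set D := \sum_(k < m) _.
have ReD_ge : m%:R - m%:R ^+ 3 * w / 2 <= complex.Re D.
  rewrite (big_morph (@complex.Re R) (@ReD R) (erefl _)).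
  have -> : m%:R - m%:R ^+ 3 * w / 2 = \sum_(k < m) (1 - m%:R ^+ 2 * w / 2).
    by rewrite sumr_const card_ord -mulr_natl; ring.
  apply: ler_sum => k _; rewrite Re_unimodular ?rnormX ?z1 ?expr1n//.
  rewrite lerD2l lerN2 ler_pM2r ?invr_gt0// /w -exprMn.
  rewrite lerXn2r ?nnegrE ?rnorm_ge0 ?mulr_ge0 ?rnorm_ge0//.
  apply: le_trans (rnorm_1subX _ z1) _; apply: ler_wpM2r; first exact: rnorm_ge0.
  by rewrite ler_nat ltnW.
have := mulr_ge0 (ler0n R m) (etrans (subr_ge0 _ _) ReD_ge).
have := sqr_ge0 (complex.Re D - m%:R); have := sqr_ge0 (complex.Im D).
by rewrite sqr_rnorm; move: (complex.Re D) (complex.Im D) m%:R => x y M; nra.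
Qed.

(** A short geometric sum is nearly maximal where [z] is close to 1, and a long
    one is bounded away from [z = 1] independently of its length. Hence the
    weight [rnorm (\sum_(k < m) z ^+ k) ^+ 2 / m ^+ 2] captures all but a bounded
    part of the square of the long sum. *)
Lemma geometric_localized z m n : rnorm z = 1 ->
  (m%:R ^+ 2 - rnorm (\sum_(k < m) z ^+ k) ^+ 2) * rnorm (\sum_(k < n) z ^+ k) ^+ 2
  <= 4 * m%:R ^+ 4.
Proof.
move=> z1; set D := rnorm (\sum_(k < n) _).
apply: (@le_trans _ _ (m%:R ^+ 4 * rnorm (1 - z) ^+ 2 * D ^+ 2)).
  by apply: ler_wpM2r; [exact: sqr_ge0|exact: rnorm_geometric_ge].
rewrite -mulrA -exprMn mulrC; apply: ler_wpM2r; first exact: exprn_ge0.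
have -> : 4 = 2 ^+ 2 :> R by ring.
by rewrite lerXn2r ?nnegrE ?mulr_ge0 ?rnorm_ge0//; exact: rnorm_geometric.
Qed.

Fixpoint signed_eval (s : seq bool) z : R[i] :=
  if s is e :: s' then (-1) ^+ e + z * signed_eval s' z else 0.

Lemma signed_evalE s z :
  signed_eval s z = \sum_(k < size s) (-1) ^+ nth false s k * z ^+ k.
Proof.
elim: s => [|e s IH] /=; first by rewrite big_ord0.
rewrite big_ord_recl /= expr0 mulr1 IH mulr_sumr; congr (_ + _).
by apply: eq_bigr => k _; rewrite /= exprS mulrCA.
Qed.

Lemma signed_eval_cat s1 s2 z :
  signed_eval (s1 ++ s2) z = signed_eval s1 z + z ^+ size s1 * signed_eval s2 z.
Proof.
elim: s1 => [|e s1 IH] /=; first by rewrite add0r mul1r.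
by rewrite IH exprS; ring.
Qed.

Lemma signed_eval_negb s z : signed_eval (map negb s) z = - signed_eval s z.
Proof.
elim: s => [|e s IH] /=; first by rewrite oppr0.
by rewrite IH; case: e => /=; ring.
Qed.

(** Signs of the two Rudin-Shapiro polynomials with [2 ^ j] terms, with [true]
    standing for -1 as in [signed_eval]. *)
Fixpoint rudin_shapiro (j : nat) : seq bool * seq bool :=
  if j is j'.+1 then
    let: (p, q) := rudin_shapiro j' in (p ++ q, p ++ map negb q)
  else ([:: false], [:: false]).

Lemma size_rudin_shapiro j :
  size (rudin_shapiro j).1 = (2 ^ j)%N /\ size (rudin_shapiro j).2 = (2 ^ j)%N.
Proof.
elim: j => [//|j] /=; case: (rudin_shapiro j) => p q /= [sp sq].
by rewrite !size_cat size_map sp sq addnn -mul2n expnS.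
Qed.

Lemma parallelogram (x y : R[i]) :
  rnorm (x + y) ^+ 2 + rnorm (x - y) ^+ 2 = 2 * (rnorm x ^+ 2 + rnorm y ^+ 2).
Proof. by rewrite !sqr_rnorm; case: x => a b; case: y => c d; simpc => /=; ring. Qed.

(** The recursion sends the values [(u, v)] at [z] to [(u + w * v, u - w * v)] with
    [w] of modulus one, and the parallelogram law doubles the sum of squares. *)
Lemma rudin_shapiro_norm j z : rnorm z = 1 ->
  rnorm (signed_eval (rudin_shapiro j).1 z) ^+ 2 +
  rnorm (signed_eval (rudin_shapiro j).2 z) ^+ 2 = 2 ^+ j.+1.
Proof.
move=> z1; elim: j => [|j IH].
  have E : signed_eval [:: false] z = 1 by rewrite /= mulr0 addr0.
  by rewrite [rudin_shapiro 0]/= E rnorm1; ring.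
have [sp _] := size_rudin_shapiro j; rewrite [rudin_shapiro _]/=.
case: (rudin_shapiro j) sp IH => p q; rewrite ![(_, _).1]/= ![(_, _).2]/= => sp IH.
rewrite !signed_eval_cat signed_eval_negb mulrN parallelogram.
by rewrite rnormM rnormX z1 expr1n mul1r IH -exprS.
Qed.

End UnimodularSums.

(** * Comparing a power with an affine function *)

Section Powers.
Variable R : realType.
Implicit Types (v S h : R).

Lemma powR_split1 v h : 0 < v -> v `^ h = v `^ (h - 1) * v.
Proof.
by move=> v0; rewrite -{3}[v]powRr1 ?ltW// -powRD ?subrK// (gt_eqF v0) implybT.
Qed.

(** These two inequalities bound the mean of a power of order [2 * h] of a
    function from the mean of its square: below [S] the power is controlled by
    [S `^ h], above [S] the ratio [v `^ (h - 1)] is compared with [S `^ (h - 1)]. *)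
Lemma powR_le_affine v S h : 0 <= v -> 0 < S -> 0 <= h <= 1 ->
  v `^ h <= S `^ h + S `^ (h - 1) * v.
Proof.
move=> v0 S0 /andP[h0 h1]; have [vS|Sv] := leP v S.
  apply: (@le_trans _ _ (S `^ h)); first by rewrite ge0_ler_powR// nnegrE ltW.
  by rewrite lerDl mulr_ge0 ?powR_ge0.
apply: (@le_trans _ _ (S `^ (h - 1) * v)); last by rewrite lerDr powR_ge0.
rewrite (powR_split1 _ (lt_trans S0 Sv)); apply: ler_wpM2r => //.
rewrite -[h - 1]opprB !powRN lef_pV2 ?posrE ?powR_gt0 ?(lt_trans S0 Sv)//.
by rewrite ge0_ler_powR ?nnegrE ?subr_ge0// ltW.
Qed.

Lemma powR_ge_affine v S h : 0 <= v -> 0 < S -> 1 <= h ->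
  S `^ (h - 1) * (v - S) <= v `^ h.
Proof.
move=> v0 S0 h1; have [vS|Sv] := leP v S.
  apply: le_trans (powR_ge0 _ _); rewrite mulr_ge0_le0 ?powR_ge0//.
  by rewrite subr_le0.
rewrite (powR_split1 _ (lt_trans S0 Sv)).
apply: (@le_trans _ _ (S `^ (h - 1) * v)).
  by apply: ler_wpM2l; rewrite ?powR_ge0// lerBlDr lerDl ltW.
apply: ler_wpM2r => //.
by rewrite ge0_ler_powR ?nnegrE ?subr_ge0// ltW.
Qed.

Lemma powR_unbounded (a K : R) : 0 < a -> exists N : nat, forall n : nat,
  (N <= n)%N -> K < n%:R `^ a.
Proof.
move=> a0; pose L := Num.max K 0.
have L0 : 0 <= L by rewrite le_max lexx orbT.
exists (Num.Def.archi_bound (L `^ a^-1)) => n Nn.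
apply: (@le_lt_trans _ _ L); first by rewrite le_max lexx.
have {1}-> : L = (L `^ a^-1) `^ a by rewrite -powRrM mulVf ?lt0r_neq0// powRr1.
rewrite gt0_ltr_powR ?nnegrE ?powR_ge0//.
by rewrite (lt_le_trans (archi_boundP (powR_ge0 _ _)))// ler_nat.
Qed.

End Powers.

(** * Signed sums along an arithmetic progression *)

Section ArithmeticProgressions.
Variable R : realType.
Implicit Types (b t q : R) (m n j : nat) (c : nat -> R[i]) (s : nat -> bool).

(** The frequencies are [0, b, ..., (n - 1) * b]: a common shift of all
    frequencies does not change the modulus. *)
Definition apsum b n c t : R[i] := tsum (fun k => k%:R * b) (iota 0 n) c t.

Definition signs s : nat -> R[i] := fun k => (-1) ^+ s k.

Definition ones : nat -> R[i] := signs (fun=> false).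

Lemma rnorm_signs s k : rnorm (signs s k) = 1.
Proof. by rewrite /signs rnormX rnormN rnorm1 expr1n. Qed.

Lemma apsumE b n c t : apsum b n c t = \sum_(k < n) c k * cis (- (b * t)) ^+ k.
Proof.
rewrite /apsum /tsum -[X in iota 0 X]subn0 -/(index_iota 0 n) big_mkord.
by apply: eq_bigr => k _; rewrite -cisX mulNrn -[b * t *+ k]mulr_natl mulrA.
Qed.

Lemma apsum_ones b n t : apsum b n ones t = \sum_(k < n) cis (- (b * t)) ^+ k.
Proof. by rewrite apsumE; apply: eq_bigr => k _; rewrite /ones /signs expr0 mul1r. Qed.

Lemma apsum_half_period b n c t : b != 0 ->
  apsum b n c (t + pi / b) = apsum b n (fun k => (-1) ^+ k * c k) t.
Proof.
move=> b0; rewrite !apsumE; apply: eq_bigr => k _.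
have -> : cis (- (b * (t + pi / b))) = -1 * cis (- (b * t)).
  have -> : - (b * (t + pi / b)) = - pi + - (b * t) by field.
  rewrite cisD; congr (_ * _).
  by rewrite /cis cosN sinN cospi sinpi oppr0; simpc.
by rewrite exprMn mulrA [c k * _]mulrC.
Qed.

Lemma apsum_period b n c t : b != 0 -> apsum b n c (t + 2 * (pi / b)) = apsum b n c t.
Proof.
move=> b0; rewrite mulrDl mul1r addrA !apsum_half_period// !apsumE.
by apply: eq_bigr => k _; rewrite !mulrA -expr2 sqrr_sign mul1r.
Qed.

(** Translation by half a period alternates the signs of the coefficients, so
    the two powers have the same mean. *)
Lemma mean_apsum b n c q : 0 < b -> 0 < q -> exists l,
  mean_value (fun t => rnorm (apsum b n c t) `^ q) l /\
  mean_value (fun t => rnorm (apsum b n (fun k => (-1) ^+ k * c k) t) `^ q) l.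
Proof.
move=> b0 q0; have bn0 := lt0r_neq0 b0.
have P0 : 0 < 2 * (pi / b) by rewrite mulr_gt0// divr_gt0// pi_gt0.
have [|l ml /(_ (pi / b)) mh] := mean_value_periodic P0
  (@continuous_powR_tsum R (fun k => k%:R * b) (iota 0 n) c q q0).
  by move=> t; rewrite -!/(apsum b n c _) apsum_period.
exists l; split; first exact: ml.
rewrite (_ : (fun t => _) = (fun t => rnorm (apsum b n c (t + pi / b)) `^ q)).
  exact: mh.
by apply/funext => t; rewrite apsum_half_period.
Qed.

Lemma mean_sqr_signs b n s : 0 < b ->
  mean_value (fun t => rnorm (apsum b n (signs s) t) ^+ 2) n%:R.
Proof.
move=> b0; have := @mean_sqr_tsum R (fun k => k%:R * b) (iota 0 n) (signs s) (iota_uniq _ _).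
rewrite (eq_bigr (fun=> 1)) => [|k _]; last by rewrite rnorm_signs expr1n.
rewrite big_const_seq count_predT size_iota iter_addr_0; apply => x y _ _.
by move/(mulIf (lt0r_neq0 b0))/(mulrIn (oner_neq0 _)).
Qed.

Definition rs_signs j : nat -> bool := nth false (rudin_shapiro j).1.

Lemma apsum_rudin_shapiro b j t :
  rnorm (apsum b (2 ^ j) (signs (rs_signs j)) t) ^+ 2 <= 2 * (2 ^ j)%:R.
Proof.
have -> : apsum b (2 ^ j) (signs (rs_signs j)) t =
    signed_eval (rudin_shapiro j).1 (cis (- (b * t))).
  by rewrite apsumE signed_evalE (size_rudin_shapiro j).1.
rewrite natrX -exprS -(rudin_shapiro_norm j (rnorm_cis (- (b * t)))).
by rewrite lerDl sqr_ge0.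
Qed.

Lemma dirichlet_le b n t : rnorm (apsum b n ones t) <= n%:R.
Proof. rewrite apsum_ones; exact: rnorm_geometric_le (rnorm_cis _). Qed.

(** Up to normalization this is the Fejer kernel. *)
Definition fejer_weight b m t : R := rnorm (apsum b m ones t) ^+ 2 / m%:R ^+ 2.

Lemma continuous_fejer_weight b m : continuous (fejer_weight b m).
Proof.
move=> t; apply: cvgM (cvg_cst _); exact: continuous_sqr_rnorm_tsum.
Qed.

Lemma mean_fejer_weight b m : 0 < b -> mean_value (fejer_weight b m) m%:R^-1.
Proof.
move=> b0; have [->|m0] := eqVneq m 0%N.
  rewrite invr0 (_ : fejer_weight b 0 = cst 0); first exact: mean_value_cst.
  by apply/funext => t; rewrite /fejer_weight expr0n /= invr0 mulr0.
rewrite (_ : fejer_weight b m =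
    fun t => m%:R ^- 2 * rnorm (apsum b m ones t) ^+ 2); last first.
  by apply/funext => t; rewrite mulrC.
rewrite (_ : m%:R^-1 = m%:R ^- 2 * m%:R :> R); last first.
  by field; rewrite pnatr_eq0.
by apply: mean_valueZ; [exact: continuous_sqr_rnorm_tsum|exact: mean_sqr_signs].
Qed.

Lemma fejer_weight01 b m t : (0 < m)%N -> 0 <= fejer_weight b m t <= 1.
Proof.
move=> m0; have M0 : 0 < m%:R ^+ 2 :> R by rewrite exprn_gt0// ltr0n.
rewrite /fejer_weight divr_ge0 ?sqr_ge0// ler_pdivrMr// mul1r.
by rewrite lerXn2r ?nnegrE ?rnorm_ge0// dirichlet_le.
Qed.

Lemma fejer_weight_localizes b m n t : (0 < m)%N ->
  (1 - fejer_weight b m t) * rnorm (apsum b n ones t) ^+ 2 <= 4 * m%:R ^+ 2.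
Proof.
move=> m0; have M0 : 0 < m%:R :> R by rewrite ltr0n.
rewrite /fejer_weight !apsum_ones.
have := geometric_localized m n (rnorm_cis (- (b * t))).
set u := rnorm _ ^+ 2; set v := rnorm _ ^+ 2 => loc.
rewrite (_ : (1 - _) * v = (m%:R ^+ 2 - u) * v / m%:R ^+ 2); last first.
  by field; rewrite gt_eqF.
by rewrite ler_pdivrMr ?exprn_gt0// (le_trans loc)// -mulrA -exprD.
Qed.

Lemma powR_half (u q : R) : 0 <= u -> u `^ q = (u ^+ 2) `^ (q / 2).
Proof. by move=> u0; rewrite -powR_mulrn// -powRrM mulrC divfK. Qed.

Lemma mean_value_affine (f g : R -> R) (lf lg x y w : R) :
  continuous f -> continuous g -> mean_value f lf -> mean_value g lg ->
  continuous (fun t => x * f t + y * g t + w) /\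
  mean_value (fun t => x * f t + y * g t + w) (x * lf + y * lg + w).
Proof.
move=> fc gc mf mg.
have cw : continuous (cst w : R -> R) by move=> t; apply: cvg_cst.
have cxy : continuous (fun t => x * f t + y * g t).
  by apply: continuous_add; exact: continuous_scale.
split; first exact: continuous_add.
apply: mean_valueD; [exact: cxy|exact: cw| |exact: mean_value_cst].
by apply: mean_valueD; [exact: continuous_scale|exact: continuous_scale
                       |exact: mean_valueZ|exact: mean_valueZ].
Qed.

(** Below exponent 2, the weight splits the power [v `^ h] of the squared
    modulus [v]. The weighted part is compared with an affine function at level
    [S], where the constant gains the factor [m%:R^-1], the mean of the weight;
    the rest at level [4 * m%:R ^+ 2], where it is bounded independently of [n]. *)
Lemma mean_dirichlet_le b m n q (S l : R) : 0 < b -> (0 < m)%N -> 0 < S -> 0 < q <= 2 ->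
  mean_value (fun t => rnorm (apsum b n ones t) `^ q) l ->
  l <= S `^ (q / 2) / m%:R + S `^ (q / 2 - 1) * n%:R + 2 * (4 * m%:R ^+ 2) `^ (q / 2).
Proof.
move=> b0 m0 S0 /andP[q0 q2] ml; set h := q / 2.
have h01 : 0 <= h <= 1 by rewrite /h; apply/andP; split; lra.
pose x := S `^ h; pose y := S `^ (h - 1); set w := 2 * _.
have [cr mr] := @mean_value_affine (fejer_weight b m)
  (fun t => rnorm (apsum b n ones t) ^+ 2) m%:R^-1 n%:R x y w
  (@continuous_fejer_weight b m) (@continuous_sqr_rnorm_tsum R _ _ _)
  (mean_fejer_weight b0) (@mean_sqr_signs b n _ b0).
apply: (mean_value_le _ cr ml mr); first exact: continuous_powR_tsum.
move=> t; rewrite powR_half ?rnorm_ge0// -/h.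
have /andP[th0 th1] := fejer_weight01 b t m0.
have loc := fejer_weight_localizes b n t m0.
set v := rnorm (apsum b n ones t) ^+ 2 in loc *.
set th := fejer_weight b m t in th0 th1 loc *.
have v0 : 0 <= v by exact: sqr_ge0.
have S'0 : 0 < 4 * m%:R ^+ 2 :> R by rewrite mulr_gt0// exprn_gt0// ltr0n.
have near_le := powR_le_affine v0 S0 h01.
have far_le := powR_le_affine v0 S'0 h01.
have far : (1 - th) * v `^ h <= w.
  apply: (@le_trans _ _ ((1 - th) *
      ((4 * m%:R ^+ 2) `^ h + (4 * m%:R ^+ 2) `^ (h - 1) * v))).
    by apply: ler_wpM2l => //; rewrite subr_ge0.
  rewrite mulrDr (_ : w = (4 * m%:R ^+ 2) `^ h + (4 * m%:R ^+ 2) `^ h); last first.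
    by rewrite /w mulr_natl mulr2n.
  apply: lerD; first by rewrite ler_piMl ?powR_ge0// lerBlDr lerDl.
  rewrite mulrCA [leRHS]powR_split1//; apply: ler_wpM2l loc; exact: powR_ge0.
have close : th * v `^ h <= x * th + y * v.
  apply: (@le_trans _ _ (th * (x + y * v))); first exact: ler_wpM2l.
  rewrite mulrDr; apply: lerD; first by rewrite mulrC.
  by rewrite ler_piMl// mulr_ge0// powR_ge0.
rewrite (_ : v `^ h = th * v `^ h + (1 - th) * v `^ h); last by ring.
exact: lerD.
Qed.

(** Above exponent 2, the part of the power outside the weight is discarded; the
    weight still carries all but [4 * m%:R ^+ 2] of the square. *)
Lemma mean_dirichlet_ge b m n q (S l : R) : 0 < b -> (0 < m)%N -> 0 < S -> 2 <= q ->
  mean_value (fun t => rnorm (apsum b n ones t) `^ q) l ->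
  S `^ (q / 2 - 1) * (n%:R - 4 * m%:R ^+ 2 - S / m%:R) <= l.
Proof.
move=> b0 m0 S0 q2 ml; set h := q / 2.
have h1 : 1 <= h by rewrite /h; lra.
pose y := S `^ (h - 1); pose x := - (y * S).
pose w := - (y * (4 * m%:R ^+ 2)).
have [cr mr] := @mean_value_affine (fejer_weight b m)
  (fun t => rnorm (apsum b n ones t) ^+ 2) m%:R^-1 n%:R x y w
  (@continuous_fejer_weight b m) (@continuous_sqr_rnorm_tsum R _ _ _)
  (mean_fejer_weight b0) (@mean_sqr_signs b n _ b0).
rewrite (_ : _ * (_ - _) = x * m%:R^-1 + y * n%:R + w); last first.
  by rewrite -/y /x /w; ring.
apply: (mean_value_le cr _ mr ml).
  by apply: continuous_powR_tsum; exact: lt_le_trans q2.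
move=> t; rewrite powR_half ?rnorm_ge0// -/h.
have /andP[th0 th1] := fejer_weight01 b t m0.
have loc := fejer_weight_localizes b n t m0.
set v := rnorm (apsum b n ones t) ^+ 2 in loc *.
set th := fejer_weight b m t in th0 th1 loc *.
have v0 : 0 <= v by exact: sqr_ge0.
apply: (@le_trans _ _ (th * v `^ h)); last by rewrite ler_piMl// powR_ge0.
apply: le_trans (ler_wpM2l th0 (powR_ge_affine v0 S0 h1)).
have -> : x * th + y * v + w = y * (v - 4 * m%:R ^+ 2 - th * S).
  by rewrite /x /w; ring.
rewrite (_ : th * (_ * _) = y * (th * (v - S))); last by rewrite -/y; ring.
apply: ler_wpM2l; first exact: powR_ge0.
by move: loc; rewrite mulrBl mul1r mulrBr; lra.
Qed.

(** With [S = m * n], the two main terms of [mean_dirichlet_le] are both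
    [(m * n) `^ h / m], small against [n `^ h] once [m] is large; the third is
    bounded in [n]. The Rudin-Shapiro sum has modulus at most [sqrt (2 * n)] and
    mean square [n], so its mean power is at least a multiple of [n `^ h]. *)
Lemma gap_lt2 q (K : R) : 0 < q < 2 -> 0 < K -> exists j, forall b lD lS, 0 < b ->
  mean_value (fun t => rnorm (apsum b (2 ^ j) ones t) `^ q) lD ->
  mean_value (fun t => rnorm (apsum b (2 ^ j) (signs (rs_signs j)) t) `^ q) lS ->
  K * lD < lS.
Proof.
move=> /andP[q0 q2] K0; pose h := q / 2.
have h0 : 0 < h by rewrite /h; lra.
have h1 : 0 < 1 - h by rewrite /h; lra.
have [N HN] := powR_unbounded (16 * K) h1.
pose m := maxn N 1; pose W : R := (4 * m%:R ^+ 2) `^ h.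
have [j Hj] := powR_unbounded (16 * K * W) h0.
exists j => b lD lS b0 mD mS.
have m0 : (0 < m)%N by rewrite leq_max orbT.
have HM : 16 * K < m%:R `^ (1 - h) by apply: HN; rewrite leq_maxl.
have Hn : 16 * K * W < (2 ^ j)%:R `^ h by apply: Hj; rewrite ltnW// ltn_expl.
set n := (2 ^ j)%N in mD mS Hn *.
have n0 : (0 < n)%N by rewrite expn_gt0.
have M0 : 0 < m%:R :> R by rewrite ltr0n.
have N0 : 0 < n%:R :> R by rewrite ltr0n.
have S0 : 0 < m%:R * n%:R :> R by rewrite mulr_gt0.
have q02 : 0 < q <= 2 by rewrite q0 ltW.
have HD := mean_dirichlet_le b0 m0 S0 q02 mD.
rewrite -/h -/W in HD.
(* Y bounds the (1 - h)-th power of the squared Rudin-Shapiro modulus. *)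
pose Y : R := (2 * n%:R) `^ (1 - h).
have Y0 : 0 < Y by rewrite powR_gt0// mulr_gt0.
have HS : n%:R <= Y * lS.
  have cS : continuous (fun t => rnorm (apsum b n (signs (rs_signs j)) t) `^ q).
    exact: continuous_powR_tsum.
  have cYS : continuous (fun t => Y * rnorm (apsum b n (signs (rs_signs j)) t) `^ q).
    exact: continuous_scale.
  refine (mean_value_le (@continuous_sqr_rnorm_tsum R _ _ _) cYS
    (@mean_sqr_signs b n (rs_signs j) b0) (@mean_valueZ R _ _ Y cS mS) _).
  move=> t; rewrite powR_half ?rnorm_ge0// -/h.
  have := apsum_rudin_shapiro b j t; rewrite -/n.
  set v := _ ^+ 2 => vn; have : 0 <= v by exact: sqr_ge0.
  rewrite le_eqVlt => /orP[/eqP <-|v0]; first by rewrite mulr_ge0// powR_ge0.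
  rewrite {1}(_ : v = v `^ (1 - h) * v `^ h); last first.
    by rewrite -powRD ?subrK ?powRr1 ?ltW// (gt_eqF v0) implybT.
  apply: ler_wpM2r; first exact: powR_ge0.
  by rewrite ge0_ler_powR ?nnegrE// ltW// mulr_gt0.
rewrite -(ltr_pM2l Y0); apply: lt_le_trans HS.
have nE : n%:R = n%:R `^ h * n%:R `^ (1 - h) :> R.
  by rewrite -powRD ?(gt_eqF N0) ?implybT// [h + _]addrC subrK powRr1// ltW.
have mE : m%:R = m%:R `^ h * m%:R `^ (1 - h) :> R.
  by rewrite -powRD ?(gt_eqF M0) ?implybT// [h + _]addrC subrK powRr1// ltW.
have two_le : 2 `^ (1 - h) <= 2 :> R.
  by rewrite -[leRHS]powRr1// ler_powR ?ler1n//; lra.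
have SE : (m%:R * n%:R) `^ (h - 1) * n%:R = (m%:R * n%:R) `^ h / m%:R :> R.
  rewrite [in RHS]powR_split1//; field; by rewrite gt_eqF.
rewrite SE in HD.
pose a := m%:R `^ h : R; pose A := m%:R `^ (1 - h) : R.
pose c := n%:R `^ h : R; pose B := n%:R `^ (1 - h) : R.
pose d := 2 `^ (1 - h) : R.
have YE : Y = d * B by rewrite /Y powRM.
have XE : (m%:R * n%:R) `^ h = a * c :> R by rewrite powRM// ltW.
have [a0 A0 c0 B0 d0] : [/\ 0 < a, 0 < A, 0 < c, 0 < B & 0 < d].
  by split; rewrite powR_gt0.
have aE : a / m%:R = A^-1 by rewrite mE -/a -/A; field; rewrite !gt_eqF.
have HD' : lD <= 2 * (c / A) + 2 * W.
  by move: HD; rewrite XE mulrAC aE; lra.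
have W0 : 0 <= W by exact: powR_ge0.
rewrite YE nE -/c -/B.
have E1 : d * B * (K * lD) <= 2 * B * (K * (2 * (c / A) + 2 * W)).
  have lD0 : 0 <= lD by apply: mean_value_ge0 mD => t; exact: powR_ge0.
  apply: ler_pM; [by rewrite mulr_ge0// ltW|by rewrite mulr_ge0// ltW| | ].
  - by rewrite ler_pM2r.
  - by rewrite ler_pM2l.
apply: le_lt_trans E1 _.
have F1 : K / A < 16^-1 by rewrite ltr_pdivrMr//; move: HM; rewrite -/A; lra.
have F2 : K * W < c / 16 by move: Hn; rewrite -/c; lra.
have -> : 2 * B * (K * (2 * (c / A) + 2 * W)) = 4 * B * (c * (K / A) + K * W).
  by field; rewrite gt_eqF.
have F3 : c * (K / A) < c * 16^-1 by rewrite ltr_pM2l.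
have F4 : c * (K / A) + K * W < c / 4 by lra.
have -> : c * B = 4 * B * (c / 4) by field.
by rewrite ltr_pM2l// mulr_gt0.
Qed.

(** Here [mean_dirichlet_ge] is used with [2 * m'] terms in the weight and
    [S = m' * n], so that the bracket is [n / 2] up to a bounded term; the factor
    [m' `^ (h - 1)] is arbitrarily large. The length [2 ^ j] exceeds
    [j = 64 * m' ^ 2], which absorbs the bounded term. *)
Lemma gap_gt2 q (K : R) : 2 < q -> 0 < K -> exists j, forall b lD lS, 0 < b ->
  mean_value (fun t => rnorm (apsum b (2 ^ j) ones t) `^ q) lD ->
  mean_value (fun t => rnorm (apsum b (2 ^ j) (signs (rs_signs j)) t) `^ q) lS ->
  K * lS < lD.
Proof.
move=> q2 K0; pose h := q / 2.
have h1 : 0 < h - 1 by rewrite /h; lra.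
have [N HN] := powR_unbounded (4 * K * 2 `^ h) h1.
pose m' := maxn N 1; pose j := (64 * m' ^ 2)%N.
exists j => b lD lS b0 mD mS.
have m'0 : (0 < m')%N by rewrite leq_max orbT.
have HM : 4 * K * 2 `^ h < m'%:R `^ (h - 1) by apply: HN; rewrite leq_maxl.
set n := (2 ^ j)%N in mD mS *.
have Hn : 64 * m'%:R ^+ 2 <= n%:R :> R.
  by rewrite -natrX -natrM ler_nat ltnW// ltn_expl.
have n0 : (0 < n)%N by rewrite expn_gt0.
have M0 : 0 < m'%:R :> R by rewrite ltr0n.
have N0 : 0 < n%:R :> R by rewrite ltr0n.
have m0 : (0 < 2 * m')%N by rewrite muln_gt0.
have S0 : 0 < m'%:R * n%:R :> R by rewrite mulr_gt0.
have HD := mean_dirichlet_ge b0 m0 S0 (ltW q2) mD.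
rewrite -/h natrM in HD.
have HS : lS <= (2 * n%:R) `^ h.
  have cS : continuous (fun t => rnorm (apsum b n (signs (rs_signs j)) t) `^ q).
    by apply: continuous_powR_tsum; exact: lt_trans q2.
  have cc : continuous (cst ((2 * n%:R) `^ h) : R -> R) by move=> t; exact: cvg_cst.
  refine (mean_value_le cS cc mS (@mean_value_cst R _) _).
  move=> t; rewrite [cst _ _]/= powR_half ?rnorm_ge0// -/h.
  rewrite ge0_ler_powR ?nnegrE ?sqr_ge0 ?mulr_ge0 ?apsum_rudin_shapiro//.
  rewrite /h; lra.
apply: lt_le_trans HD.
apply: (@le_lt_trans _ _ (K * (2 * n%:R) `^ h)); first by rewrite ler_pM2l.
have -> : (2 * n%:R) `^ h = 2 `^ h * (n%:R `^ (h - 1) * n%:R) :> R.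
  by rewrite powRM// (powR_split1 h N0).
rewrite powRM ?ltW//.
have -> : m'%:R * n%:R / (2%:R * m'%:R) = n%:R / 2 :> R by field; rewrite gt_eqF.
pose B := n%:R `^ (h - 1) : R; pose A := m'%:R `^ (h - 1) : R.
have B0 : 0 < B by rewrite powR_gt0.
have A0 : 0 < A by rewrite powR_gt0.
rewrite -/A -/B; rewrite -/A in HM.
apply: (@lt_le_trans _ _ (A * B * (n%:R / 4))).
  have -> : K * (2 `^ h * (B * n%:R)) = K * 2 `^ h * (B * n%:R) by ring.
  have -> : A * B * (n%:R / 4) = A / 4 * (B * n%:R) by field.
  by rewrite ltr_pM2r ?mulr_gt0//; lra.
by rewrite ler_pM2l ?mulr_gt0//; nra.
Qed.

(** Away from [p = 2], sums with constant signs and sums with Rudin-Shapiro signs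
    have norms of different orders, in a direction that depends on the side of 2
    on which [p] lies. *)
Lemma besicovitch_gap (p : \bar R) (C : R) : (1%:E <= p)%E -> p != 2%:E -> 0 < C ->
  exists n s1 s2, forall b, 0 < b ->
  C * besicovitch_norm p (fun t => rnorm (apsum b n (signs s1) t)) <
  besicovitch_norm p (fun t => rnorm (apsum b n (signs s2) t)).
Proof.
case: p => [q| |]//; last first.
  move=> _ _ C0; pose j := Num.Def.archi_bound (2 * C ^+ 2).
  exists (2 ^ j)%N, (rs_signs j), (fun=> false) => b b0; rewrite /besicovitch_norm.
  set n := (2 ^ j)%N.
  have n0 : 0 < n%:R :> R by rewrite ltr0n expn_gt0.
  have Hn : 2 * C ^+ 2 < n%:R.
    apply: (@lt_le_trans _ _ j%:R); last by rewrite ler_nat ltnW// ltn_expl.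
    by apply: archi_boundP; rewrite mulr_ge0// sqr_ge0.
  have ub : has_ubound (range (fun t => rnorm (apsum b n (signs (fun=> false)) t))).
    by exists n%:R => _ [t _ <-]; exact: dirichlet_le.
  have D0 : rnorm (apsum b n (signs (fun=> false)) 0) = n%:R.
    rewrite -/ones apsum_ones mulr0 oppr0 cis0.
    under eq_bigr do rewrite expr1n.
    rewrite sumr_const card_ord -[in LHS](rmorph1 (@real_complex R)) -rmorphMn.
    by rewrite /= expr0n addr0 sqrtr_sqr ger0_norm.
  apply: (@lt_le_trans _ _ n%:R); last first.
    by rewrite -D0; apply: ub_le_sup => //; exists 0.
  apply: (@le_lt_trans _ _ (C * Num.sqrt (2 * n%:R))).
    rewrite ler_pM2l//; apply: ge_sup.
      by exists (rnorm (apsum b n (signs (rs_signs j)) 0)); exists 0.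
    move=> _ [t _ <-]; rewrite rnorm_sqrt.
    by rewrite ler_wsqrtr// apsum_rudin_shapiro.
  rewrite -[ltRHS]ger0_norm ?ltW// -sqrtr_sqr -[C]ger0_norm ?ltW// -sqrtr_sqr -sqrtrM ?sqr_ge0//.
  rewrite ltr_sqrt ?exprn_gt0//; nra.
rewrite lee_fin eqe => q1 q2 C0.
have q0 : 0 < q by exact: lt_le_trans q1.
have key s1 s2 n : (forall b l1 l2, 0 < b ->
    mean_value (fun t => rnorm (apsum b n (signs s1) t) `^ q) l1 ->
    mean_value (fun t => rnorm (apsum b n (signs s2) t) `^ q) l2 ->
    C `^ q * l1 < l2) -> forall b, 0 < b ->
  C * besicovitch_norm q%:E (fun t => rnorm (apsum b n (signs s1) t)) <
  besicovitch_norm q%:E (fun t => rnorm (apsum b n (signs s2) t)).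
  move=> H b b0.
  have [l1 [m1 _]] := mean_apsum n (signs s1) b0 q0.
  have [l2 [m2 _]] := mean_apsum n (signs s2) b0 q0.
  have l10 : 0 <= l1 by apply: mean_value_ge0 m1 => t; exact: powR_ge0.
  have l12 := H _ _ _ b0 m1 m2.
  rewrite (besicovitch_norm_mean q0 m1) (besicovitch_norm_mean q0 m2).
  have -> : C * l1 `^ q^-1 = (C `^ q * l1) `^ q^-1.
    by rewrite powRM ?powR_ge0// -powRrM mulfV ?gt_eqF// powRr1// ltW.
  rewrite gt0_ltr_powR ?invr_gt0// nnegrE ?mulr_ge0 ?powR_ge0//.
  by rewrite ltW// (le_lt_trans _ l12)// mulr_ge0 ?powR_ge0.
have Cq : 0 < C `^ q by rewrite powR_gt0.
have [qlt|qgt|E] := ltgtP q 2; last by rewrite E eqxx in q2.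
  have [|j Hj] := @gap_lt2 q (C `^ q) _ Cq; first by rewrite q0.
  exists (2 ^ j)%N, (fun=> false), (rs_signs j); apply: key => b l1 l2 b0.
  exact: Hj.
have [j Hj] := gap_gt2 qgt Cq.
exists (2 ^ j)%N, (rs_signs j), (fun=> false); apply: key => b l1 l2 b0 m1 m2.
exact: Hj m2 m1.
Qed.

Lemma besicovitch_alternate (p : \bar R) b n c :
  (1%:E <= p)%E -> 0 < b ->
  besicovitch_norm p (fun t => rnorm (apsum b n (fun k => (-1) ^+ k * c k) t)) =
  besicovitch_norm p (fun t => rnorm (apsum b n c t)).
Proof.
case: p => [q q1 b0|_ b0|//].
  have q0 : 0 < q by rewrite lee_fin in q1; exact: lt_le_trans q1.
  have [l [m1 m2]] := mean_apsum n c b0 q0.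
  by rewrite (besicovitch_norm_mean q0 m1) (besicovitch_norm_mean q0 m2).
rewrite /besicovitch_norm; congr sup; apply/seteqP; split => _ [t _ <-].
  by exists (t + pi / b) => //; rewrite apsum_half_period// gt_eqF.
exists (t - pi / b) => //; rewrite -apsum_half_period ?gt_eqF//.
by rewrite subrK.
Qed.

End ArithmeticProgressions.

(** * Coefficients of finite sums *)

Section Coefficients.
Variables (R : realType) (X : normedModType R[i]).
Variables (e : nat -> X) (es : nat -> {linear X -> R[i]^o}).
Hypothesis ces : coefficient_functionals e es.
Implicit Types (A B D F : {fset nat}) (f g a : nat -> R[i]) (x y z : X).

Lemma coef_sum A f m :
  es m (\sum_(j <- A) f j *: e j) = if m \in A then f m else 0.
Proof.
have [_ bi] := ces.
have E (j : nat) : es m (f j *: e j) = f j * (m == j)%:R by rewrite linearZ/= bi.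
rewrite linear_sum/=; under eq_bigr do rewrite E.
case: ifPn => [mA|mA].
  rewrite (big_fsetD1 m)//= eqxx mulr1 big_seq big1 ?addr0// => j.
  by rewrite !inE => /andP[/negPf jm _]; rewrite eq_sym jm mulr0.
rewrite big_seq big1// => j jA; case: eqP => [mj|]; last by rewrite mulr0.
by rewrite mj jA in mA.
Qed.

Lemma sum_widen A D f : (A `<=` D)%fset ->
  \sum_(j <- A) f j *: e j = \sum_(j <- D) (if j \in A then f j else 0) *: e j.
Proof.
move=> AD; rewrite -(big_fset_incl _ AD) => [|j _ /negPf ->]; last by rewrite scale0r.
by rewrite big_seq [RHS]big_seq; apply: eq_bigr => j ->.
Qed.

Lemma bproj_sum A F a : (F `<=` A)%fset ->
  bproj e es A (\sum_(n <- F) a n *: e n) = \sum_(n <- F) a n *: e n.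
Proof.
move=> FA; rewrite /bproj (sum_widen _ FA).
by apply: eq_bigr => j _; rewrite -(sum_widen _ FA) coef_sum.
Qed.

Lemma bprojB A x y : bproj e es A (x - y) = bproj e es A x - bproj e es A y.
Proof.
rewrite /bproj -sumrB; apply: eq_bigr => j _.
by rewrite raddfB/= scalerBl.
Qed.

Lemma coef_bproj A x m : es m (bproj e es A x) = if m \in A then es m x else 0.
Proof. exact: coef_sum. Qed.

Lemma indic_sum_setD A B eps : (B `<=` A)%fset ->
  indic_sum e eps A = indic_sum e eps B + indic_sum e eps (A `\` B)%fset.
Proof.
move=> BA; rewrite /indic_sum (big_fsetID _ (mem B)); congr (_ + _).
  apply: eq_fbigl => j; rewrite !inE /=.
  by apply/andP/idP => [[]//|jB]; split => //; exact: (fsubsetP BA).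
by apply: eq_fbigl => j; rewrite !inE andbC.
Qed.

Lemma coef_indic_add A eps x : bsupp es x `&` [set` A] = set0 -> forall j,
  es j (indic_sum e eps A + x) = if j \in A then eps j else es j x.
Proof.
move=> xA j; rewrite raddfD/= coef_sum; case: ifP => jA; last by rewrite add0r.
suff -> : es j x = 0 by rewrite addr0.
apply: contrapT => /eqP xj; suff : set0 j by [].
by rewrite -xA; split.
Qed.

Lemma bproj_indic_add A eps x : bsupp es x `&` [set` A] = set0 ->
  bproj e es A (indic_sum e eps A + x) = indic_sum e eps A.
Proof.
move=> xA; rewrite /bproj [RHS]big_seq [LHS]big_seq; apply: eq_bigr => j jA.
by rewrite coef_indic_add// jA.
Qed.

Lemma bsupp0 : bsupp es 0 = set0.
Proof. by apply/seteqP; split => j //=; rewrite /bsupp /= raddf0 eqxx. Qed.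

Lemma best_error_le x m y :
  (bsupp es y #<= `I_m)%card -> best_error es x m <= rnorm (x - y).
Proof.
move=> sy; apply: ge_inf; last by exists y.
by exists 0 => _ [z _ <-]; exact: rnorm_ge0.
Qed.

End Coefficients.

(** * Each greedy-type property bounds the effect of changing signs *)

Section SignBounds.
Variables (R : realType) (X : normedModType R[i]).
Variables (e : nat -> X) (es : nat -> {linear X -> R[i]^o}).
Hypothesis ces : coefficient_functionals e es.
Implicit Types (A B : {fset nat}) (s : nat -> bool) (x : X).

(** The common consequence of all the properties except semi-greediness that
    fails when [p] is not 2. *)
Definition sign_bounded (C : R) : Prop := forall A s1 s2,
  rnorm (indic_sum e (signs R s2) A) <= C * rnorm (indic_sum e (signs R s1) A).

Lemma unimodular_signs A s : unimodular_on A (signs R s).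
Proof. by move=> j _; apply/eqP; rewrite -rnorm_eq1 rnorm_signs. Qed.

Lemma SUCC_sign_bounded : SUCC e -> exists2 C, 0 < C & sign_bounded C.
Proof.
by move=> [C C0 H]; exists C => // A s1 s2; apply: H => //; exact: unimodular_signs.
Qed.

(** Splitting [A] according to whether the two signs agree, both parts of the
    second sum are, up to sign, restrictions of the first sum. *)
Lemma largest_coefs_sign_bounded :
  quasi_greedy_largest_coefs e es -> exists2 C, 0 < C & sign_bounded C.
Proof.
move=> [C C0 H]; exists (C + C); first exact: addr_gt0.
have sub A B s : (B `<=` A)%fset ->
    rnorm (indic_sum e (signs R s) B) <= C * rnorm (indic_sum e (signs R s) A).
  move=> BA; rewrite (indic_sum_setD _ _ BA); apply: H.
  - exact: unimodular_signs.
  - apply/seteqP; split => // j [/= + jB].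
    by rewrite /bsupp /= /indic_sum (coef_sum ces) !inE jB eqxx.
  - move=> j; rewrite /indic_sum (coef_sum ces); case: ifP => _.
      by rewrite rnorm_signs.
    by rewrite (rnorm0 R[i]).
move=> A s1 s2; pose B := [fset j in A | s1 j == s2 j]%fset.
have BA : (B `<=` A)%fset by apply/fsubsetP => j; rewrite !inE => /andP[].
rewrite (indic_sum_setD _ _ BA) mulrDl.
have -> : indic_sum e (signs R s2) B = indic_sum e (signs R s1) B.
  rewrite /indic_sum big_seq [RHS]big_seq; apply: eq_bigr => j.
  by rewrite !inE /signs => /andP[_ /eqP ->].
have -> : indic_sum e (signs R s2) (A `\` B)%fset = - indic_sum e (signs R s1) (A `\` B)%fset.
  rewrite /indic_sum -sumrN big_seq [RHS]big_seq; apply: eq_bigr => j.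
  rewrite !inE /signs => /andP[+ jA]; rewrite jA /= -scaleNr.
  by case: (s1 j); case: (s2 j) => //= _; rewrite ?expr0 ?expr1 ?opprK.
apply: le_trans (rnormD _ _) _; rewrite rnormN.
by apply: lerD; apply: sub => //; exact: fsubsetDl.
Qed.

Lemma quasi_greedy_largest : quasi_greedy e es -> quasi_greedy_largest_coefs e es.
Proof.
move=> [C C0 H]; exists C => // A eps x uA xA xle.
rewrite -{1}(bproj_indic_add ces eps xA); apply: H => j k jA kA.
rewrite !(coef_indic_add ces _ xA) jA (negPf kA) uA//.
by rewrite -(normr1 R[i]) le_rnorm rnorm1; exact: xle.
Qed.

(** If the error is at most a multiple of a quantity that never exceeds the norm,
    the projections are bounded by the triangle inequality. *)
Lemma bproj_error_quasi_greedy (E : X -> {fset nat} -> R) :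
  (forall x A, E x A <= rnorm x) ->
  (exists2 C : R, 0 < C & forall x A, greedy_set es x A ->
    rnorm (x - bproj e es A x) <= C * E x A) -> quasi_greedy e es.
Proof.
move=> Ele [C C0 H]; exists (C + 1); first exact: addr_gt0.
move=> x A gA; rewrite -[bproj e es A x](subKr x).
apply: le_trans (rnormB _ _) _; rewrite mulrDl mul1r addrC lerD2r.
by apply: le_trans (H _ _ gA) _; rewrite ler_pM2l.
Qed.

Lemma greedy_quasi_greedy : greedy e es -> quasi_greedy e es.
Proof.
apply: bproj_error_quasi_greedy => x A; rewrite -{2}[x]subr0; apply: best_error_le.
by rewrite bsupp0; exact: card_ge0.
Qed.

Lemma almost_greedy_quasi_greedy : almost_greedy e es -> quasi_greedy e es.
Proof.
apply: bproj_error_quasi_greedy => x A; apply: ge_inf.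
  by exists 0 => _ [z _ <-]; exact: rnorm_ge0.
exists fset0 => //=.
by rewrite /bproj big_seq_fset0 subr0.
Qed.

Lemma nearly_unconditional_largest :
  nearly_unconditional e es -> quasi_greedy_largest_coefs e es.
Proof.
move=> /(_ 1); rewrite ltr01 lexx => /(_ isT)[C C0 H]; exists C => // A eps x uA xA xle.
have u1 j : j \in A -> rnorm (eps j) = 1 by move=> jA; apply/eqP; rewrite rnorm_eq1 uA.
rewrite -{1}(bproj_indic_add ces eps xA).
apply: H => j; rewrite (coef_indic_add ces _ xA); last by move=> jA; rewrite jA u1.
by case: ifP => [jA|_]; [rewrite u1|exact: xle].
Qed.

End SignBounds.

(** * The Hilbert space case *)

Section Hilbert.
Variables (R : realType) (lam : nat -> R) (X : completeNormedModType R[i]).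
Variables (e : nat -> X) (es : nat -> {linear X -> R[i]^o}).
Hypothesis inj_lam : injective lam.
Hypothesis HX : Hp_completion lam 2%:E e.
Hypothesis ces : coefficient_functionals e es.
Implicit Types (A B D F : {fset nat}) (f a : nat -> R[i]) (x y z : X).

Local Notation P := (bproj e es).

Lemma sqr_norm_sum A a :
  rnorm (\sum_(n <- A) a n *: e n) ^+ 2 = \sum_(n <- A) rnorm (a n) ^+ 2.
Proof. by have [-> _] := HX; exact: Hp_norm2. Qed.

(** On finite sums this is the norm formula over the union of the two supports. *)
Lemma pythagoras_sum F a A : let w := \sum_(n <- F) a n *: e n in
  rnorm w ^+ 2 = rnorm (w - P A w) ^+ 2 + rnorm (P A w) ^+ 2.
Proof.
move=> w; pose D := (F `|` A)%fset.
have FD : (F `<=` D)%fset by exact: fsubsetUl.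
have AD : (A `<=` D)%fset by exact: fsubsetUr.
pose a' n := if n \in F then a n else 0.
have wE : w = \sum_(n <- D) a' n *: e n by rewrite /w (sum_widen _ _ FD).
have PE : P A w = \sum_(n <- D) (if n \in A then a' n else 0) *: e n.
  rewrite /bproj (sum_widen _ _ AD); apply: eq_bigr => n _.
  by rewrite /w (coef_sum ces).
have QE : w - P A w = \sum_(n <- D) (if n \in A then 0 else a' n) *: e n.
  rewrite PE wE -sumrB; apply: eq_bigr => n _.
  by rewrite -scalerBl; case: ifP; rewrite ?subrr ?subr0.
rewrite QE PE wE !sqr_norm_sum -big_split; apply: eq_bigr => n _.
by case: ifP; rewrite (rnorm0 (R[i])) expr0n/= ?addr0 ?add0r.
Qed.

Lemma dense_span_eq (f g : X -> R[i]^o) : continuous f -> continuous g ->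
  (forall F a, f (\sum_(n <- F) a n *: e n) = g (\sum_(n <- F) a n *: e n)) ->
  forall x, f x = g x.
Proof.
move=> fc gc fg x; apply: contrapT => fgx.
have hc : continuous (fun x => f x - g x) by move=> y; apply: cvgB (fc y) (gc y).
have O : open [set y | f y - g y != 0].
  rewrite (_ : mkset _ = ~` ((fun y => f y - g y) @^-1` [set 0])); last first.
    by apply/seteqP; split => y /= /eqP.
  apply: closed_openC; apply: preimage_closed => //.
  apply: accessible_closed_set1; apply: hausdorff_accessible; exact: norm_hausdorff.
have [] := HX.2 _ _ O; first by exists x; rewrite /= subr_eq0; apply/eqP.
by move=> y [/= + [F [a yE]]]; rewrite yE fg subrr eqxx.
Qed.

Lemma continuous_sqr_norm (h : X -> X) : continuous h ->
  continuous (fun x => `|h x| ^+ 2 : R[i]^o).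
Proof.
move=> hc x.
have nh : continuous (fun x => `|h x| : R[i]^o).
  by move=> y; apply: continuous_comp; [exact: hc|exact: norm_continuous].
exact: cvgM (nh x) (nh x).
Qed.

Lemma continuous_bproj A : continuous (P A).
Proof.
move=> x; rewrite /bproj; elim: (enum_fset A) => [|j r IH].
  rewrite (_ : (fun x => _) = cst 0); first exact: cvg_cst.
  by apply/funext => y; rewrite big_nil.
rewrite (_ : (fun x => _) = (fun y => es j y *: e j + \sum_(j <- r) es j y *: e j)); last first.
  by apply/funext => y; rewrite big_cons.
rewrite /continuous_at; apply: cvgD IH.
by apply: cvgZr_tmp; exact: ces.1.
Qed.

Lemma pythagoras x A : rnorm x ^+ 2 = rnorm (x - P A x) ^+ 2 + rnorm (P A x) ^+ 2.
Proof.
apply: complexI; rewrite rmorphD/= -!sqr_normE.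
apply: (dense_span_eq (f := fun x => `|x| ^+ 2 : R[i]^o)
  (g := fun x => `|x - P A x| ^+ 2 + `|P A x| ^+ 2 : R[i]^o)).
- by apply: continuous_sqr_norm => y; exact: cvg_id.
- have c1 : continuous (fun x => x - P A x).
    by move=> z; apply: cvgB; [exact: cvg_id|exact: continuous_bproj].
  have c2 := @continuous_bproj A.
  by move=> y; apply: cvgD (continuous_sqr_norm c1 (x := y)) (continuous_sqr_norm c2 (x := y)).
move=> F a; rewrite !sqr_normE -rmorphD/=; congr (_%:C).
exact: pythagoras_sum.
Qed.

Lemma rnorm_bproj_le x A : rnorm (P A x) <= rnorm x.
Proof.
by rewrite -ler_sqr_rnorm (pythagoras x A) lerDr sqr_ge0.
Qed.

(** If all coefficients of [z] vanish then [z] is orthogonal to every finite sum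
    [w], so [`|z - w| ^+ 2 = `|z| ^+ 2 + `|w| ^+ 2]; by density this holds for
    every [w], in particular for [w = z]. *)
Lemma coef_total z : (forall n, es n z = 0) -> z = 0.
Proof.
move=> z0; apply/eqP; rewrite -normr_eq0 -(sqrf_eq0 `|z|).
have H x : `|z - x| ^+ 2 = `|z| ^+ 2 + `|x| ^+ 2.
  apply: (dense_span_eq (f := fun x => `|z - x| ^+ 2 : R[i]^o)
    (g := fun x => `|z| ^+ 2 + `|x| ^+ 2 : R[i]^o)).
  - by apply: continuous_sqr_norm => y; apply: cvgB; [exact: cvg_cst|exact: cvg_id].
  - move=> y; apply: cvgD; first exact: cvg_cst.
    by apply: continuous_sqr_norm => t; exact: cvg_id.
  move=> F a; set w := \sum_(n <- F) _.
  have Pz : P F z = 0 by rewrite /bproj big1// => j _; rewrite z0 scale0r.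
  have Pw : P F w = w by apply: (bproj_sum ces).
  rewrite !sqr_normE -rmorphD/=; congr (_%:C).
  by rewrite (pythagoras _ F) (bprojB e es) Pz Pw sub0r opprK subrK rnormN.
have := H z; rewrite subrr normr0 expr0n/= => /esym/eqP.
by rewrite -mulr2n mulrn_eq0.
Qed.

(** Outside the common part, every coefficient over [A] dominates every one over
    [B], and [A] has at least as many of them. *)
Lemma greedy_sum_le x A B : greedy_set es x A -> (#|` B| <= #|` A|)%N ->
  \sum_(j <- B) rnorm (es j x) ^+ 2 <= \sum_(j <- A) rnorm (es j x) ^+ 2.
Proof.
move=> gA BA; set g := fun j => rnorm (es j x) ^+ 2.
have g0 j : 0 <= g j by exact: sqr_ge0.
have gle (a b : nat) : a \in (A `\` B)%fset -> b \in (B `\` A)%fset -> g b <= g a.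
  rewrite !inE => /andP[_ aA] /andP[bA _].
  by rewrite lerXn2r ?nnegrE ?rnorm_ge0// -le_rnorm; exact: gA.
have card_le : (#|` (B `\` A)%fset| <= #|` (A `\` B)%fset|)%N.
  by rewrite -(leq_add2l #|` (A `&` B)%fset|) cardfsID fsetIC cardfsID.
have spl (C D : {fset nat}) : \sum_(j <- C) g j =
    \sum_(j <- (C `&` D)%fset) g j + \sum_(j <- (C `\` D)%fset) g j.
  rewrite (big_fsetID _ (mem D)); congr (_ + _); apply: eq_fbigl => j.
    by apply/idP/idP; rewrite !inE => /andP[-> ->].
  by apply/idP/idP; rewrite !inE => /andP[-> ->].
suff key : \sum_(j <- (B `\` A)%fset) g j <= \sum_(j <- (A `\` B)%fset) g j.
  by rewrite (spl A B) (spl B A) fsetIC lerD2l.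
have [c0|c0] := posnP #|` (A `\` B)%fset|.
  have : #|` (B `\` A)%fset| = 0%N by apply/eqP; rewrite -leqn0 -c0.
  by move=> /cardfs0_eq ->; rewrite big_seq_fset0 sumr_ge0.
(* Compare each of the terms over B with each of those over A by a double sum. *)
rewrite -(ler_pM2l (_ : 0 < #|` (A `\` B)%fset|%:R)) ?ltr0n//.
apply: (@le_trans _ _ (\sum_(a <- (A `\` B)%fset) \sum_(b <- (B `\` A)%fset) g b)).
  by rewrite big_const_seq count_predT iter_addr_0 mulr_natl.
apply: (@le_trans _ _ (\sum_(a <- (A `\` B)%fset) \sum_(b <- (B `\` A)%fset) g a)).
  rewrite big_seq [leRHS]big_seq; apply: ler_sum => a aAB.
  rewrite big_seq [leRHS]big_seq; apply: ler_sum => b bBA; exact: gle.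
rewrite mulr_sumr; apply: ler_sum => a _.
rewrite big_const_seq count_predT iter_addr_0 -[leLHS]mulr_natl.
by apply: ler_wpM2r => //; rewrite ler_nat.
Qed.

Lemma greedy_best_proj x A B : greedy_set es x A -> (#|` B| <= #|` A|)%N ->
  rnorm (x - P A x) <= rnorm (x - P B x).
Proof.
move=> gA BA; rewrite -ler_sqr_rnorm.
have := greedy_sum_le gA BA.
have := pythagoras x A; have := pythagoras x B; rewrite !(sqr_norm_sum _ (es ^~ x)).
lra.
Qed.

(** Projecting [x - y] away from the support [B] of [y] decreases the norm and
    leaves [x - P B x], since [y = P B y]. *)
Lemma greedy_best x A y : greedy_set es x A -> (bsupp es y #<= `I_#|` A|)%card ->
  rnorm (x - P A x) <= rnorm (x - y).
Proof.
move=> gA supy; pose B := fset_set (bsupp es y).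
have fin : finite_set (bsupp es y) by exact: card_le_finite supy (finite_II _).
have yB : y = P B y.
  apply/eqP; rewrite -subr_eq0; apply/eqP; apply: coef_total => n.
  rewrite raddfB/= (coef_bproj ces) in_fset_set//.
  case: ifPn => [_|]; first by rewrite subrr.
  by rewrite notin_setE /bsupp /= => /negP; rewrite negbK => /eqP ->; rewrite subrr.
apply: le_trans (greedy_best_proj gA (geq_card_fset_set supy)) _.
rewrite -ler_sqr_rnorm (pythagoras (x - y) B) -/B.
have -> : x - y - P B (x - y) = x - P B x.
  by rewrite (bprojB e es) -yB opprB addrA subrK.
by rewrite lerDl sqr_ge0.
Qed.

Lemma hilbert_greedy : greedy e es.
Proof.
exists 1 => // x A gA; rewrite mul1r; apply: lb_le_inf.
  by exists (rnorm (x - 0)), 0 => //=; rewrite bsupp0; exact: card_ge0.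
by move=> _ [y sy <-]; exact: greedy_best.
Qed.

Lemma hilbert_almost_greedy : almost_greedy e es.
Proof.
exists 1 => // x A gA; rewrite mul1r; apply: lb_le_inf.
  by exists (rnorm (x - P fset0 x)), fset0 => //=; rewrite cardfs0.
by move=> _ [B BA <-]; exact: greedy_best_proj.
Qed.

Lemma hilbert_semi_greedy : semi_greedy e es.
Proof.
have [C C0 H] := hilbert_greedy; exists C => // x A gA; apply: le_trans (H x A gA).
rewrite /dist_span.
apply: ge_inf; last by exists (es ^~ x).
by exists 0 => _ [c _ <-]; exact: rnorm_ge0.
Qed.

Lemma hilbert_quasi_greedy : quasi_greedy e es.
Proof. by exists 1 => // x A _; rewrite mul1r rnorm_bproj_le. Qed.

Lemma hilbert_nearly_unconditional : nearly_unconditional e es.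
Proof. by move=> t _; exists 1 => // x A _ _; rewrite mul1r rnorm_bproj_le. Qed.

Lemma hilbert_SUCC : SUCC e.
Proof.
exists 1 => // A B eps eps' AB uA uB; rewrite mul1r.
rewrite -ler_sqr_rnorm !sqr_norm_sum.
have one (C : {fset nat}) (c : nat -> R[i]) : unimodular_on C c ->
    \sum_(n <- C) rnorm (c n) ^+ 2 = #|` C|%:R.
  move=> u; rewrite big_seq (eq_bigr (fun=> 1)) => [|j jC]; last by rewrite u// expr1n.
  by rewrite -big_seq big_const_seq count_predT iter_addr_0.
by rewrite (one _ _ uA) (one _ _ uB) ler_nat fsubset_leq_card.
Qed.

End Hilbert.

(** * Restriction to an arithmetic progression of frequencies *)

Section Progression.
Variables (R : realType) (lam : nat -> R) (p : \bar R) (X : completeNormedModType R[i]).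
Variables (e : nat -> X).
Hypothesis HX : Hp_completion lam p e.
Variables (N : nat) (sigma : nat -> nat) (a b : R).
Hypothesis b0 : 0 < b.
Hypothesis lam_sigma : forall k, (k < N)%N -> lam (sigma k) = a + k%:R * b.
Implicit Types (s : seq nat) (c f : nat -> R[i]).

Definition rank (m : nat) : nat := index m (map sigma (iota 0 N)).

Lemma sigma_inj : {in iota 0 N &, injective sigma}.
Proof.
move=> j k; rewrite !mem_iota !add0n /= => jN kN E.
have := lam_sigma jN; rewrite E lam_sigma// => /addrI /(mulIf (lt0r_neq0 b0)) /eqP.
by rewrite eqr_nat => /eqP.
Qed.

Lemma rankK k : (k < N)%N -> rank (sigma k) = k.
Proof.
move=> kN; have u : uniq (map sigma (iota 0 N)).
  by rewrite map_inj_in_uniq ?iota_uniq//; exact: sigma_inj.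
have E : sigma k = nth 0%N (map sigma (iota 0 N)) k.
  by rewrite (nth_map 0%N) ?size_iota// nth_iota.
by rewrite /rank {1}E index_uniq// size_map size_iota.
Qed.

Definition ap_set s : {fset nat} := seq_fset tt (map sigma s).

Lemma big_ap_set (V : nmodType) s (F : nat -> V) : uniq s -> {subset s <= iota 0 N} ->
  \sum_(m <- ap_set s) F m = \sum_(k <- s) F (sigma k).
Proof.
move=> us sN; rewrite (perm_big _ (seq_fset_perm _ _)) undup_id ?big_map//.
by rewrite map_inj_in_uniq// => j k js ks; apply: sigma_inj; exact: sN.
Qed.

Lemma card_ap_set s : uniq s -> {subset s <= iota 0 N} -> #|` ap_set s| = size s.
Proof.
move=> us sN; rewrite size_seq_fset undup_id ?size_map//.
by rewrite map_inj_in_uniq// => j k js ks; apply: sigma_inj; exact: sN.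
Qed.

(** The common shift [a] of the frequencies only contributes the unimodular
    factor [cis (- (a * t))]. *)
Lemma norm_progression s c : uniq s -> {subset s <= iota 0 N} ->
  rnorm (\sum_(k <- s) c k *: e (sigma k)) =
  besicovitch_norm p (fun t => rnorm (tsum (fun k => k%:R * b) s c t)).
Proof.
move=> us sN.
have crank (k : nat) : k \in s -> rank (sigma k) = k.
  by move=> /sN; rewrite mem_iota => /andP[_]; exact: rankK.
have -> : \sum_(k <- s) c k *: e (sigma k) = \sum_(m <- ap_set s) c (rank m) *: e m.
  by rewrite big_ap_set// big_seq [RHS]big_seq; apply: eq_bigr => k ks; rewrite crank.
rewrite HX.1 Hp_norm_besicovitch; congr (besicovitch_norm p _); apply/funext => t.
rewrite /tsum big_ap_set//.
rewrite (_ : \sum_(k <- s) _ = cis (- (a * t)) * \sum_(k <- s) c k * cis (- (k%:R * b * t))).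
  by rewrite rnormM rnorm_cis mul1r.
rewrite mulr_sumr big_seq [RHS]big_seq; apply: eq_bigr => k ks.
rewrite crank// lam_sigma; last by have := sN _ ks; rewrite mem_iota.
by rewrite mulrDl opprD cisD mulrCA.
Qed.

Lemma norm_progression_full c :
  rnorm (\sum_(k <- iota 0 N) c k *: e (sigma k)) =
  besicovitch_norm p (fun t => rnorm (apsum b N c t)).
Proof. by rewrite norm_progression ?iota_uniq. Qed.

End Progression.

(** * Failure away from p = 2 *)

Lemma sum_even_odd (V : nmodType) n (F : nat -> V) :
  \sum_(k <- iota 0 n.*2) F k = \sum_(k <- iota 0 n) F k.*2 + \sum_(k <- iota 0 n) F k.*2.+1.
Proof.
have E m : iota 0 m = index_iota 0 m by rewrite /index_iota subn0.
rewrite !E; elim: n => [|n IH]; first by rewrite !big_geq// addr0.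
by rewrite doubleS !big_nat_recr//= IH -!addrA; congr (_ + _); rewrite addrCA.
Qed.

Section Failure.
Variables (R : realType) (lam : nat -> R) (p : \bar R) (X : completeNormedModType R[i]).
Variables (e : nat -> X) (es : nat -> {linear X -> R[i]^o}).
Hypothesis APlam : arbitrarily_large_AP lam.
Hypothesis p1 : (1%:E <= p)%E.
Hypothesis p2 : p != 2%:E.
Hypothesis HX : Hp_completion lam p e.
Hypothesis ces : coefficient_functionals e es.

Lemma progression_exists N : exists (sigma : nat -> nat) (a b : R), 0 < b /\
  forall k, (k < N)%N -> lam (sigma k) = a + k%:R * b.
Proof.
have [a [b [b0 H]]] := APlam N.
have /choice[sigma Hs] : forall k, exists m, (k < N)%N -> lam m = a + k.+1%:R * b.
  move=> k; have [kN|] := ltnP k N; last by exists 0%N.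
  have [|m _ E] := H (a + k.+1%:R * b); first by exists k.+1.
  by exists m.
exists sigma, (a + b), b; split => // k kN.
by rewrite Hs// -natr1 mulrDl mul1r addrA addrAC.
Qed.

Lemma not_sign_bounded C : 0 < C -> ~ sign_bounded e C.
Proof.
move=> C0 H; have [n [s1 [s2 gap]]] := besicovitch_gap p1 p2 C0.
have [sigma [a [b [b0 Hs]]]] := progression_exists n.
pose A := ap_set sigma (iota 0 n).
have E s : indic_sum e (signs R (s \o rank n sigma)) A =
    \sum_(k <- iota 0 n) signs R s k *: e (sigma k).
  rewrite /indic_sum (big_ap_set b0 Hs) ?iota_uniq// big_seq [RHS]big_seq.
  apply: eq_bigr => k; rewrite mem_iota => /andP[_ kn].
  by rewrite /signs /= (rankK b0 Hs).
have := H A (s1 \o rank n sigma) (s2 \o rank n sigma).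
rewrite !E !(norm_progression_full HX b0 Hs) => /le_lt_trans /(_ (gap _ b0)).
by rewrite ltxx.
Qed.

(** Put the large sum on the even and the small sum on the odd places of a
    progression of length [2 * n]. The odd places form a greedy set of the total,
    and the large sum is a competitor, so the best error is at most the small
    norm. But no combination of the odd vectors brings the total below the large
    norm: alternating the signs along the progression preserves norms, so
    averaging with it is a projection of norm one that removes the odd places. *)
Lemma not_semi_greedy : ~ semi_greedy e es.
Proof.
move=> [C C0 H]; have [n [s1 [s2 gap]]] := besicovitch_gap p1 p2 C0.
have [sigma [a [b [b0 Hs]]]] := progression_exists n.*2.
pose odds := [seq k.*2.+1 | k <- iota 0 n]; pose evens := [seq k.*2 | k <- iota 0 n].
have uo : uniq odds by rewrite map_inj_uniq ?iota_uniq// => j k [/double_inj].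
have ue : uniq evens by rewrite map_inj_uniq ?iota_uniq//; exact: double_inj.
have so : {subset odds <= iota 0 n.*2}.
  by move=> _ /mapP[k + ->]; rewrite !mem_iota/= !add0n ltn_Sdouble.
have se : {subset evens <= iota 0 n.*2}.
  by move=> _ /mapP[k + ->]; rewrite !mem_iota/= !add0n ltn_double.
pose D := ap_set sigma (iota 0 n.*2); pose A := ap_set sigma odds.
pose B := ap_set sigma evens.
pose u k : bool := if odd k then s1 k./2 else s2 k./2.
pose eps := signs R (u \o rank n.*2 sigma).
have eps1 j : `|eps j| = 1 by apply/eqP; rewrite -rnorm_eq1 rnorm_signs.
have AD : (A `<=` D)%fset.
  by apply/fsubsetP => j; rewrite !seq_fsetE => /mapP[k ko ->]; apply: map_f; exact: so.
have b2 : 0 < 2 * b by rewrite mulr_gt0.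
have normO (c : nat -> R[i]) : rnorm (\sum_(k <- iota 0 n) c k *: e (sigma k.*2.+1)) =
    besicovitch_norm p (fun t => rnorm (apsum (2 * b) n c t)).
  apply: (norm_progression_full (sigma := fun k => sigma k.*2.+1) (a := a + b) HX b2) => k kn.
  by rewrite Hs ?ltn_Sdouble// -natr1 -mul2n natrM; ring.
have normE (c : nat -> R[i]) : rnorm (\sum_(k <- iota 0 n) c k *: e (sigma k.*2)) =
    besicovitch_norm p (fun t => rnorm (apsum (2 * b) n c t)).
  apply: (norm_progression_full (sigma := fun k => sigma k.*2) (a := a) HX b2) => k kn.
  by rewrite Hs ?ltn_double// -mul2n natrM; ring.
have epsO : indic_sum e eps A = \sum_(k <- iota 0 n) signs R s1 k *: e (sigma k.*2.+1).
  rewrite /indic_sum (big_ap_set b0 Hs)// big_map big_seq [RHS]big_seq.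
  apply: eq_bigr => k; rewrite mem_iota => /andP[_ kn]; congr (_ *: _).
  by rewrite /eps /signs /= (rankK b0 Hs) ?ltn_Sdouble// /u /= odd_double /= uphalf_double.
have epsE : indic_sum e eps B = \sum_(k <- iota 0 n) signs R s2 k *: e (sigma k.*2).
  rewrite /indic_sum (big_ap_set b0 Hs)// big_map big_seq [RHS]big_seq.
  apply: eq_bigr => k; rewrite mem_iota => /andP[_ kn]; congr (_ *: _).
  by rewrite /eps /signs /= (rankK b0 Hs) ?ltn_double// /u /= odd_double /= doubleK.
have xE : indic_sum e eps D = indic_sum e eps B + indic_sum e eps A.
  rewrite /indic_sum !(big_ap_set b0 Hs) ?iota_uniq// sum_even_odd.
  by rewrite !big_map.
pose x := indic_sum e eps D.
have gA : greedy_set es x A.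
  have xm m : es m x = if m \in D then eps m else 0 by exact: (coef_sum ces).
  move=> j k jA kA; rewrite !xm (fsubsetP AD _ jA) eps1.
  by case: ifP => _; rewrite ?eps1 ?normr0.
have cardA : #|` A| = n by rewrite (card_ap_set b0 Hs)// size_map size_iota.
have cardB : #|` B| = n by rewrite (card_ap_set b0 Hs)// size_map size_iota.
have best : best_error es x #|` A| <=
    besicovitch_norm p (fun t => rnorm (apsum (2 * b) n (signs R s1) t)).
  rewrite -normO -epsO.
  rewrite (_ : indic_sum e eps A = x - indic_sum e eps B); last first.
    by rewrite /x xE [X in X - _]addrC addrK.
  apply: best_error_le; rewrite cardA -cardB.
  apply: (@card_le_trans _ _ _ [set` B]).
    apply: subset_card_le => j /=; rewrite /bsupp /= /indic_sum (coef_sum ces).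
    by case: ifP => //; rewrite eqxx.
  have /card_eq_fsetP : #|` B| = #|` B| by [].
  by rewrite card_eq_le => /andP[].
have dist : besicovitch_norm p (fun t => rnorm (apsum (2 * b) n (signs R s2) t)) <= dist_span e x A.
  apply: lb_le_inf; first by exists (rnorm (x - \sum_(j <- A) 0 *: e j)), (fun=> 0).
  move=> _ [c _ <-]; rewrite -normE -epsE.
  pose g k := if odd k then signs R s1 k./2 - c (sigma k) else signs R s2 k./2.
  pose O := \sum_(k <- iota 0 n) g k.*2.+1 *: e (sigma k.*2.+1).
  have EE : \sum_(k <- iota 0 n) g k.*2 *: e (sigma k.*2) = indic_sum e eps B.
    by rewrite epsE; apply: eq_bigr => k _; rewrite /g odd_double doubleK.
  have W1 : x - \sum_(j <- A) c j *: e j = \sum_(k <- iota 0 n.*2) g k *: e (sigma k).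
    rewrite sum_even_odd EE /x xE -addrA; congr (_ + _).
    rewrite epsO (big_ap_set b0 Hs)// big_map -sumrB; apply: eq_bigr => k _.
    by rewrite /g /= odd_double /= uphalf_double scalerBl.
  have W2 : rnorm (x - \sum_(j <- A) c j *: e j) =
      rnorm (\sum_(k <- iota 0 n.*2) ((-1) ^+ k * g k) *: e (sigma k)).
    by rewrite W1 !(norm_progression_full HX b0 Hs) besicovitch_alternate.
  have W3 : \sum_(k <- iota 0 n.*2) ((-1) ^+ k * g k) *: e (sigma k) = indic_sum e eps B - O.
    rewrite sum_even_odd -EE /O -sumrN; congr (_ + _); apply: eq_bigr => k _.
      by rewrite -signr_odd odd_double mul1r.
    by rewrite -signr_odd /= odd_double mulN1r scaleNr.
  (* Adding the sum with alternated signs doubles the even part. *)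
  have W4 : indic_sum e eps B *+ 2 =
      (x - \sum_(j <- A) c j *: e j) + (indic_sum e eps B - O).
    by rewrite W1 sum_even_odd EE -/O addrACA subrr addr0 mulr2n.
  have : rnorm (indic_sum e eps B *+ 2) <= rnorm (x - \sum_(j <- A) c j *: e j) *+ 2.
    by rewrite W4 (le_trans (rnormD _ _))// [in leRHS]mulr2n {3}W2 W3.
  by rewrite normrMn [in leLHS]mulr2n ReD -mulr2n lerMn2r.
have := le_trans dist (H _ _ gA).
move=> /le_trans /(_ (ler_wpM2l (ltW C0) best)) /le_lt_trans /(_ (gap _ b2)).
by rewrite ltxx.
Qed.

End Failure.

Unset Implicit Arguments.

Theorem corollary5p2 (R : realType) (lam : nat -> R) (p : \bar R)
    (X : completeNormedModType R[i]) (e : nat -> X)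
    (es : nat -> {linear X -> R[i]^o}) :
  frequency lam ->
  arbitrarily_large_AP lam ->
  (1%:E <= p)%E ->
  Hp_completion lam p e ->
  coefficient_functionals e es ->
  (greedy e es <-> p = 2%:E) /\
  (almost_greedy e es <-> p = 2%:E) /\
  (semi_greedy e es <-> p = 2%:E) /\
  (quasi_greedy e es <-> p = 2%:E) /\
  (nearly_unconditional e es <-> p = 2%:E) /\
  (quasi_greedy_largest_coefs e es <-> p = 2%:E) /\
  (SUCC e <-> p = 2%:E).
Proof.
move=> [_ lam_incr _] APlam p1 HX ces.
have inj_lam : injective lam.
  by move=> m n E; have [/lam_incr|/lam_incr|//] := ltngtP m n; rewrite E ltxx.
have [p2|p2] := eqVneq p 2%:E.
  rewrite p2 in HX *.
  have qg := hilbert_quasi_greedy inj_lam HX ces.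
  have holds (Q : Prop) : Q -> (Q <-> 2%:E = 2%:E :> \bar R) by split.
  refine (conj _ (conj _ (conj _ (conj _ (conj _ (conj _ _))))));
    apply: holds => //.
  - exact: hilbert_greedy inj_lam HX ces.
  - exact: hilbert_almost_greedy inj_lam HX ces.
  - exact: hilbert_semi_greedy inj_lam HX ces.
  - exact: hilbert_nearly_unconditional inj_lam HX ces.
  - exact: quasi_greedy_largest ces qg.
  - exact: hilbert_SUCC inj_lam HX.
have notSB : ~ exists2 C, 0 < C & sign_bounded e C.
  by move=> [C C0]; exact: (not_sign_bounded APlam p1 p2 HX).
have notL : ~ quasi_greedy_largest_coefs e es.
  by move/(largest_coefs_sign_bounded ces).
have notQ : ~ quasi_greedy e es by move/(quasi_greedy_largest ces).
have fails (Q : Prop) : ~ Q -> (Q <-> p = 2%:E).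
  by move=> nQ; split => [/nQ //|pE]; rewrite pE eqxx in p2.
refine (conj _ (conj _ (conj _ (conj _ (conj _ (conj _ _))))));
  apply: fails => //.
- by move/greedy_quasi_greedy.
- by move/almost_greedy_quasi_greedy.
- exact: (not_semi_greedy APlam p1 p2 HX ces).
- by move/(nearly_unconditional_largest ces).
- by move/SUCC_sign_bounded.
Qed.
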